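(* A $3$-dimensional polytope $P\subset\mathbb{R}^3$ is equiprojective if and only if, for every edge direction $u$ of $P$, either (i) $C_P(u)=u^\perp$, or (ii) $C_P(u)$ and the relative interior of $-C_P(u)$ form a partition of $u^\perp$ (i.e. they are disjoint and their union is $u^\perp$).
   Context: A $3$-dimensional polytope $P\subset\mathbb{R}^3$ is $k$-equiprojective when its orthogonal projection onto any plane that is not orthogonal to a facet of $P$ is a polygon with exactly $k$ vertices; it is equiprojective if it is $k$-equiprojective for some $k$. For a polytope $P\subset\mathbb{R}^3$ and a face $F$ of $P$, the normal cone is $N_P(F)=\{u\in\mathbb{R}^3:\ u\cdot x\le u\cdot y \text{ for all } x\in P,\ y\in F\}$; normal cones at edges are $2$-dimensional. For a non-zero $u\in\mathbb{R}^3$, the aggregated cone $C_P(u)$ is the union of all $2$-dimensional normal cones of $P$ that are contained in the plane $u^\perp$. A vector $u\in\mathbb{S}^2$ is an edge direction of $P$ when its first non-zero coordinate is positive and some edge of $P$ has its difference of vertices equal to a multiple of $u$. *)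

(* Defs.v *)
From HB Require Import structures.
From mathcomp Require Import all_boot all_order all_algebra.
From mathcomp Require Import boolp classical_sets reals.

Set Implicit Arguments.
Unset Strict Implicit.
Unset Printing Implicit Defensive.

Import Order.TTheory GRing.Theory Num.Theory.
Local Open Scope ring_scope.
Local Open Scope classical_set_scope.

Section Defs.
Variable R : realType.

Notation vec := 'rV[R]_3.

Definition dot (u v : vec) : R := \sum_(i < 3) u 0 i * v 0 i.

Definition perp (u : vec) : set vec := [set w | dot w u = 0].

Definition conv (V : seq vec) : set vec :=
  [set x | exists w : 'I_(size V) -> R,
      (forall i, 0 <= w i) /\ \sum_i w i = 1 /\ x = \sum_i w i *: V`_i].

Definition aff (S : set vec) : set vec :=
  [set x | exists (n : nat) (p : 'I_n -> vec) (w : 'I_n -> R),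
      (forall i, S (p i)) /\ \sum_i w i = 1 /\ x = \sum_i w i *: p i].

Definition dim_ge (S : set vec) (d : nat) : Prop :=
  exists (p0 : vec) (p : 'I_d -> vec),
    S p0 /\ (forall i, S (p i)) /\ row_free (\matrix_(i < d) (p i - p0)).

Definition dim_eq (S : set vec) (d : nat) : Prop :=
  dim_ge S d /\ ~ dim_ge S d.+1.

Definition relint (S : set vec) : set vec :=
  [set x | S x /\ exists eps : R, 0 < eps /\
     forall y, aff S y -> dot (y - x) (y - x) < eps -> S y].

Definition extreme (S : set vec) : set vec :=
  [set x | S x /\ forall y z (t : R), S y -> S z -> 0 < t < 1 ->
      x = t *: y + (1 - t) *: z -> y = z].

Definition card_eq (S : set vec) (k : nat) : Prop :=
  exists s : seq vec, uniq s /\ size s = k /\ forall x, x \in s <-> S x.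

Definition polytope3 (P : set vec) : Prop :=
  (exists V : seq vec, P = conv V) /\ dim_ge P 3.

Definition is_face (P F : set vec) : Prop :=
  exists c : vec, F = [set x | P x /\ forall y, P y -> dot c y <= dot c x].

Definition is_edge (P E : set vec) : Prop := is_face P E /\ dim_eq E 1.
Definition is_facet (P F : set vec) : Prop := is_face P F /\ dim_eq F 2.

Definition ncone (P F : set vec) : set vec :=
  [set u | forall x y, P x -> F y -> dot u x <= dot u y].

Definition agg_cone (P : set vec) (u : vec) : set vec :=
  [set w | exists F, is_face P F /\ dim_eq (ncone P F) 2 /\
                     ncone P F `<=` perp u /\ ncone P F w].

Definition proj (d : vec) (x : vec) : vec := x - (dot x d / dot d d) *: d.

(* the plane d^perp is orthogonal to the facet F: a normal of F lies in d^perp *)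
Definition plane_orth_facet (d : vec) (F : set vec) : Prop :=
  exists n : vec, n != 0 /\ dot n d = 0 /\
    forall x y, F x -> F y -> dot n (x - y) = 0.

Definition k_equiprojective (P : set vec) (k : nat) : Prop :=
  forall d : vec, d != 0 ->
    (forall F, is_facet P F -> ~ plane_orth_facet d F) ->
    card_eq (extreme (proj d @` P)) k.

Definition equiprojective (P : set vec) : Prop :=
  exists k : nat, k_equiprojective P k.

Definition edge_direction (P : set vec) (u : vec) : Prop :=
  dot u u = 1 /\
  (exists i : 'I_3, (forall j : 'I_3, (j < i)%N -> u 0 j = 0) /\ 0 < u 0 i) /\
  exists E a b (t : R), is_edge P E /\ extreme E a /\ extreme E b /\
                        a != b /\ b - a = t *: u.

Definition negset (S : set vec) : set vec := [set x | S (- x)].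

End Defs.

(* Main.v *)
From HB Require Import structures.
From mathcomp Require Import all_boot all_order all_algebra.
From mathcomp Require Import interval_inference boolp classical_sets reals.
From mathcomp Require Import filter topology convex.
From mathcomp Require Import ring lra zify.
(* [Defs] comes last because its [conv] shadows the one of [convex]. *)
Require Import Defs.

Set Implicit Arguments.
Unset Strict Implicit.
Unset Printing Implicit Defensive.

Import Order.TTheory GRing.Theory Num.Theory.
Local Open Scope ring_scope.
Local Open Scope classical_set_scope.

(** Fix the list [S] of vertices of [P].  For a direction [d] parallel to no
    facet, every vertex of the projected polygon has exactly one successor in
    counterclockwise order, so the number of vertices is the number of ordered
    pairs [(a, b)] of vertices such that [d . ((b - a) x (v - a)) > 0] for all
    other vertices [v]; this condition says that [(b - a) x d] lies in the
    relative interior of the normal cone of the edge [ab].  The pairs parallel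
    to a given [u] therefore contribute [[r in C(u)] + [-r in C(u)]] with
    [r = u x d].

    Under (i) this contribution is always 2, under (ii) it is always 1, so [P]
    is equiprojective.  Conversely, let [P] be [k]-equiprojective and evaluate
    the count at [u + e x] and [u - e x] for small [e > 0] and generic [x].
    For a pair not parallel to [u] the two indicators add up to a number that
    does not depend on [x]: if the limiting normal [u x (b - a)] is a facet
    normal, then exactly one of them is 1, and otherwise they do not see [x].
    Since the total is [2 k], the contribution of the pairs parallel to [u] is
    constant in [x] as well.  Hence [[r in C(u)] + [-r in C(u)]] is the same for
    all generic [r] in the plane orthogonal to [u]; the value 2 gives (i) and
    the value 1 gives (ii). *)

(** * Vectors of R^3 *)

Section Coordinates.
Variable R : realType.
Implicit Types u v : 'rV[R]_3.

Lemma row3P u v :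
  u 0 0 = v 0 0 -> u 0 1 = v 0 1 -> u 0 2 = v 0 2 -> u = v.
Proof.
move=> e0 e1 e2; apply/rowP => -[[|[|[|//]]] lt_i3].
- by rewrite (_ : Ordinal lt_i3 = 0) //; exact: val_inj.
- by rewrite (_ : Ordinal lt_i3 = 1) //; exact: val_inj.
- by rewrite (_ : Ordinal lt_i3 = 2) //; exact: val_inj.
Qed.

Lemma dotE u v : dot u v = u 0 0 * v 0 0 + u 0 1 * v 0 1 + u 0 2 * v 0 2.
Proof.
rewrite /dot !big_ord_recl big_ord0 addr0 addrA.
by congr (_ + u 0 _ * v 0 _ + u 0 _ * v 0 _); exact: val_inj.
Qed.

Definition cross u v : 'rV[R]_3 :=
  \row_i [:: u 0 1 * v 0 2 - u 0 2 * v 0 1;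
             u 0 2 * v 0 0 - u 0 0 * v 0 2;
             u 0 0 * v 0 1 - u 0 1 * v 0 0]`_i.

End Coordinates.

Ltac vector_ring :=
  solve [ do 2 rewrite ?dotE ?mxE /=; ring
        | apply: row3P; do 2 rewrite ?dotE ?mxE /=; ring ].

Section VectorAlgebra.
Variable R : realType.
Notation vec := 'rV[R]_3.
Implicit Types (u v w p q r d l : vec) (s t : R).

Lemma dotC u v : dot u v = dot v u. Proof. vector_ring. Qed.
Lemma dotDl u v w : dot (u + v) w = dot u w + dot v w. Proof. vector_ring. Qed.
Lemma dotDr u v w : dot w (u + v) = dot w u + dot w v. Proof. vector_ring. Qed.
Lemma dotBl u v w : dot (u - v) w = dot u w - dot v w. Proof. vector_ring. Qed.
Lemma dotBr u v w : dot w (u - v) = dot w u - dot w v. Proof. vector_ring. Qed.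
Lemma dotNl u v : dot (- u) v = - dot u v. Proof. vector_ring. Qed.
Lemma dotNr u v : dot u (- v) = - dot u v. Proof. vector_ring. Qed.
Lemma dotZl t u v : dot (t *: u) v = t * dot u v. Proof. vector_ring. Qed.
Lemma dotZr t u v : dot u (t *: v) = t * dot u v. Proof. vector_ring. Qed.
Lemma dot0l u : dot 0 u = 0. Proof. vector_ring. Qed.
Lemma dot0r u : dot u 0 = 0. Proof. vector_ring. Qed.

Lemma dot_ge0 u : 0 <= dot u u.
Proof. by rewrite dotE -!expr2 !addr_ge0 ?sqr_ge0. Qed.

Lemma dot_eq0 u : (dot u u == 0) = (u == 0).
Proof.
apply/eqP/eqP => [|->]; last exact: dot0l.
by rewrite dotE => e; apply: row3P; rewrite !mxE; nra.
Qed.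

Lemma dot_gt0 u : (0 < dot u u) = (u != 0).
Proof. by rewrite lt_def dot_ge0 andbT dot_eq0. Qed.

Lemma dot_eq1_neq0 u : dot u u = 1 -> u != 0.
Proof. by rewrite -dot_gt0 => ->. Qed.

Lemma crossC u v : cross u v = - cross v u. Proof. vector_ring. Qed.
Lemma crossvv u : cross u u = 0. Proof. vector_ring. Qed.
Lemma crossZl t u v : cross (t *: u) v = t *: cross u v.
Proof. vector_ring. Qed.
Lemma crossZr t u v : cross u (t *: v) = t *: cross u v.
Proof. vector_ring. Qed.
Lemma crossDl u v w : cross (u + v) w = cross u w + cross v w.
Proof. vector_ring. Qed.
Lemma crossDr u v w : cross u (v + w) = cross u v + cross u w.
Proof. vector_ring. Qed.
Lemma crossNl u v : cross (- u) v = - cross u v. Proof. vector_ring. Qed.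
Lemma crossNr u v : cross u (- v) = - cross u v. Proof. vector_ring. Qed.
Lemma cross0l u : cross 0 u = 0. Proof. vector_ring. Qed.
Lemma cross0r u : cross u 0 = 0. Proof. vector_ring. Qed.
Lemma dot_cross d p q : dot d (cross p q) = dot (cross d p) q.
Proof. vector_ring. Qed.
Lemma dot_crossl p q : dot p (cross p q) = 0. Proof. vector_ring. Qed.
Lemma dot_crossr p q : dot q (cross p q) = 0. Proof. vector_ring. Qed.

Lemma cross_crossr p q r : cross p (cross q r) = dot p r *: q - dot p q *: r.
Proof. vector_ring. Qed.

Lemma cauchy_schwarz u v : dot u v ^+ 2 <= dot u u * dot v v.
Proof.
have := dot_ge0 (cross u v).
have -> : dot (cross u v) (cross u v) = dot u u * dot v v - dot u v ^+ 2.
  vector_ring.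
by rewrite subr_ge0.
Qed.

Lemma cross_eq0P p q : p != 0 -> cross p q = 0 <-> exists t, q = t *: p.
Proof.
move=> p0; split=> [pq0|[t ->]]; last by rewrite crossZr crossvv scaler0.
exists (dot p q / dot p p); have := cross_crossr p p q.
rewrite pq0 cross0r => /esym/eqP; rewrite subr_eq0 => /eqP e.
by rewrite mulrC -scalerA e scalerA mulVf ?scale1r ?dot_eq0.
Qed.

Lemma cross_eq0_trans u p q :
  u != 0 -> cross u p = 0 -> cross u q = 0 -> cross p q = 0.
Proof.
move=> u0 /(cross_eq0P _ u0)[s ->] /(cross_eq0P _ u0)[t ->].
by rewrite crossZl crossZr crossvv !scaler0.
Qed.

Lemma orthogonal_cross n p q : cross p q != 0 -> dot n p = 0 -> dot n q = 0 ->
  exists t, n = t *: cross p q.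
Proof.
move=> pq0 np nq; apply/cross_eq0P => //.
by rewrite crossC cross_crossr np nq !scale0r subrr oppr0.
Qed.

Lemma dot_parallel_eq u a b w :
  u != 0 -> cross u (b - a) = 0 -> dot w u = 0 -> dot w b = dot w a.
Proof.
move=> u0 /(cross_eq0P _ u0)[t e] wu; apply/eqP.
by rewrite -subr_eq0 -dotBr e dotZr wu mulr0.
Qed.

Lemma dot_eq_sub w a b : dot w b = dot w a <-> dot w (b - a) = 0.
Proof. by rewrite dotBr; split=> [->|/subr0_eq//]; rewrite subrr. Qed.

Lemma cross_sub_base l a x y :
  cross l (x - a) = 0 -> cross l (y - a) = 0 -> cross l (y - x) = 0.
Proof.
move=> lx ly; have -> : y - x = (y - a) - (x - a) by rewrite opprB addrA subrK.
by rewrite crossDr crossNr lx ly subrr.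
Qed.

Lemma exists_orthogonal l : exists2 n, n != 0 & dot n l = 0.
Proof.
pose e i : vec := delta_mx 0 i.
have e_neq0 i : e i != 0.
  by apply/eqP => /rowP/(_ i); rewrite !mxE !eqxx => /eqP; rewrite oner_eq0.
have [l2|l2] := eqVneq (cross l (e 2)) 0; last first.
  by exists (cross l (e 2)); rewrite // dotC dot_crossl.
exists (e 0) => //; have /rowP/(_ 1) := l2; rewrite dotE !mxE /=; lra.
Qed.

Fact proj_is_linear d : linear (proj d).
Proof.
move=> t x y; rewrite /proj dotDl dotZl mulrDl scalerDl scalerBr scalerA -mulrA.
by rewrite opprD addrACA.
Qed.

HB.instance Definition _ d := GRing.isLinear.Build R vec vec *:%R (proj d)
  (proj_is_linear d).

Lemma dot_proj d w x : dot w (proj d x) = dot (proj d w) x.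
Proof. by rewrite /proj dotBr dotBl dotZl dotZr [dot d x]dotC; ring. Qed.

Lemma dot_projd d w : d != 0 -> dot (proj d w) d = 0.
Proof. by move=> d0; rewrite /proj dotBl dotZl divfK ?subrr ?dot_eq0. Qed.

Lemma proj_id d w : dot w d = 0 -> proj d w = w.
Proof. by move=> wd; rewrite /proj wd mul0r scale0r subr0. Qed.

Lemma dot_proj_id d w x : dot w d = 0 -> dot w (proj d x) = dot w x.
Proof. by move=> wd; rewrite dot_proj proj_id. Qed.

Lemma cross_proj d x : cross d (proj d x) = cross d x.
Proof. by rewrite crossDr crossNr crossZr crossvv scaler0 subr0. Qed.

Lemma proj_inj_cross d x y : proj d x = proj d y -> cross d (x - y) = 0.
Proof. by move=> e; rewrite -cross_proj linearB /= e subrr cross0r. Qed.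

End VectorAlgebra.

Arguments cross_eq0P {R p q}.
Arguments dot_eq_sub {R w a b}.

Section Directions.
Variable R : realType.
Notation vec := 'rV[R]_3.
Implicit Types (u l : vec) (t : R).

Definition lead_coord u :=
  if u 0 0 != 0 then u 0 0 else if u 0 1 != 0 then u 0 1 else u 0 2.

Definition normalized u := dot u u = 1 /\ 0 < lead_coord u.

Definition direction l := (Num.sg (lead_coord l) / Num.sqrt (dot l l)) *: l.

Lemma lead_coord_eq0 u : (lead_coord u == 0) = (u == 0).
Proof.
apply/eqP/eqP => [|->]; last by rewrite /lead_coord !mxE eqxx.
rewrite /lead_coord; have [u0|/eqP//] := eqVneq (u 0 0) 0.
have [u1 /= u2|/eqP//] := eqVneq (u 0 1) 0.
by apply: row3P; rewrite mxE.
Qed.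

Lemma lead_coordZ t u : lead_coord (t *: u) = t * lead_coord u.
Proof.
have [->|t0] := eqVneq t 0.
  by rewrite scale0r mul0r; apply/eqP; rewrite lead_coord_eq0.
by rewrite /lead_coord !mxE !mulf_eq0 (negPf t0) /=; case: ifP => //; case: ifP.
Qed.

Lemma lead_coord_gt0P u : 0 < lead_coord u <->
  exists i : 'I_3, (forall j : 'I_3, (j < i)%N -> u 0 j = 0) /\ 0 < u 0 i.
Proof.
rewrite /lead_coord; split=> [|[i [u_lt ui]]].
  have [u0|_] := eqVneq (u 0 0) 0; last by exists 0.
  have [u1|_] /= := eqVneq (u 0 1) 0 => [u2|]; [exists 2|exists 1];
    split=> // j.
    by case: j => [[|[|[]]]//] lt_j3 _; [rewrite -[RHS]u0|rewrite -[RHS]u1];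
      congr (u 0 _); exact: val_inj.
  case: j => [[|[]]//] lt_j3 _.
  by rewrite -[RHS]u0; congr (u 0 _); exact: val_inj.
case: i ui u_lt => [[|[|[|//]]]] lt_i3 ui u_lt.
- have i0 : Ordinal lt_i3 = 0 by exact: val_inj.
  by rewrite i0 in ui; rewrite gt_eqF.
- have i1 : Ordinal lt_i3 = 1 by exact: val_inj.
  by rewrite i1 in ui; rewrite (u_lt 0)// eqxx /= gt_eqF.
- have i2 : Ordinal lt_i3 = 2 by exact: val_inj.
  by rewrite i2 in ui; rewrite (u_lt 0)// (u_lt 1)// eqxx.
Qed.

Lemma normalized_neq0 u : normalized u -> u != 0.
Proof. by move=> [uu _]; exact: dot_eq1_neq0. Qed.

Lemma normalized_direction l : l != 0 -> normalized (direction l).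
Proof.
move=> l0; have ll : 0 < dot l l by rewrite dot_gt0.
split.
  rewrite dotZl dotZr mulrA -expr2 exprMn exprVn sqr_sqrtr ?ltW//.
  by rewrite sqr_sg lead_coord_eq0 l0 mul1r mulVf ?gt_eqF.
rewrite lead_coordZ mulrAC -normrEsg divr_gt0 ?sqrtr_gt0//.
by rewrite normr_gt0 lead_coord_eq0.
Qed.

Lemma direction_eqP l u : l != 0 -> normalized u ->
  direction l = u <-> cross u l = 0.
Proof.
move=> l0 nu; have u0 := normalized_neq0 nu; have [uu lead_u] := nu.
split=> [<-|/(cross_eq0P u0)[t lt]]; first by rewrite crossZl crossvv scaler0.
have t0 : t != 0 by apply: contra_neq l0 => t0; rewrite lt t0 scale0r.
rewrite /direction lt dotZl dotZr uu mulr1 -expr2 sqrtr_sqr lead_coordZ sgrM.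
rewrite (gtr0_sg lead_u) mulr1 scalerA mulrAC -normrEsg.
by rewrite mulfV ?scale1r ?normr_eq0.
Qed.

End Directions.

(** * Finite sequences *)

Lemma exists_seq_max d (O : orderType d) (T : eqType) (s : seq T) (f : T -> O) :
  s != [::] -> exists2 x, x \in s & {in s, forall y, (f y <= f x)%O}.
Proof.
case: s => // x0 s _; set S := x0 :: s.
have [i _ max_i] :=
  @arg_maxP _ _ _ (ord0 : 'I_(size S)) xpredT (fun i => f (nth x0 S i)) isT.
exists (nth x0 S i) => [|y]; first exact: mem_nth.
by case/(nthP x0) => j lt_jS <-; exact: (max_i (Ordinal lt_jS)).
Qed.

Lemma exists_max_ratio (F : realFieldType) (T : eqType) (s : seq T)
    (f g : T -> F) : s != [::] -> {in s, forall x, 0 < g x} ->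
  exists2 x, x \in s & {in s, forall y, f y * g x <= f x * g y}.
Proof.
move=> s0 g_gt0; have [x xs max_x] := exists_seq_max (fun x => f x / g x) s0.
exists x => // y ys; have := max_x y ys.
by rewrite ler_pdivrMr ?g_gt0// mulrAC ler_pdivlMr ?g_gt0.
Qed.

Lemma filter_in_seq (T : eqType) (I : Type) (F : set_system I) (s : seq T)
    (Q : T -> I -> Prop) : Filter F ->
  {in s, forall x, \forall i \near F, Q x i} ->
  \forall i \near F, {in s, forall x, Q x i}.
Proof.
move=> FF; elim: s => [|x s IH] Qs; first by apply: filterE => i y.
have Qx : \forall i \near F, Q x i by apply: Qs; rewrite mem_head.
have {}IH : \forall i \near F, {in s, forall y, Q y i}.
  by apply: IH => y ys; apply: Qs; rewrite inE ys orbT.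
by apply: filterS2 Qx IH => i Qxi Qsi y /predU1P[->|/Qsi].
Qed.

Lemma count_predI_predC (T : Type) (p q : pred T) (s : seq T) :
  count p s = (count (predI p q) s + count (predI p (predC q)) s)%N.
Proof.
by rewrite -[LHS]size_filter -(count_predC q) !count_filter; congr addn;
  apply: eq_count => z /=; rewrite andbC.
Qed.

Lemma count_uniq_has (T : eqType) (p : pred T) (s : seq T) : uniq s ->
  {in s &, forall x y, p x -> p y -> x = y} -> count p s = has p s.
Proof.
move=> uniq_s p_inj; have [/hasP[x xs px]|] := boolP (has p s); last first.
  by rewrite has_count lt0n negbK => /eqP.
rewrite [RHS]/= -[RHS]/(nat_of_bool true) -xs -count_uniq_mem//.
apply: eq_in_count => y ys; apply/idP/eqP => [py|-> //].
exact: p_inj.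
Qed.

Lemma count_fibers (T U : eqType) (h : T -> U) (p : pred T) (s : seq T)
    (D : seq U) : uniq D -> {in s, forall x, p x -> h x \in D} ->
  count p s = (\sum_(u <- D) count (fun x => (h x == u) && p x) s)%N.
Proof.
move=> uniq_D; elim: s => [|x s IH] hD /=; first by rewrite big1.
rewrite big_split /= -IH => [|y ys]; last by apply: hD; rewrite inE ys orbT.
congr addn; have [px|_] := boolP (p x); last first.
  by rewrite big1 // => u; rewrite andbF.
under eq_bigr do rewrite andbT.
rewrite (bigD1_seq (h x)) ?hD ?mem_head//= eqxx big1 // => u.
by rewrite eq_sym => /negPf->.
Qed.

Lemma eq_in_count_add (T : eqType) (p q p' q' : pred T) (s : seq T) :
  {in s, forall x, p x + q x = p' x + q' x}%N ->
  (count p s + count q s = count p' s + count q' s)%N.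
Proof.
elim: s => //= x s IH eq_s; rewrite addnACA eq_s ?mem_head// IH 1?addnACA//.
by move=> y ys; apply: eq_s; rewrite inE ys orbT.
Qed.

Lemma count_allpairs_swap (T : Type) (p : pred (T * T)) (s : seq T) :
  count p [seq (x, y) | x <- s, y <- s] =
  count (fun z => p (z.2, z.1)) [seq (x, y) | x <- s, y <- s].
Proof.
rewrite -!sum1_count big_mkcond [RHS]big_mkcond !big_allpairs.
exact: exchange_big.
Qed.

Lemma card_eq_inj (R : realType) (X : set 'rV[R]_3) k k' :
  card_eq X k -> card_eq X k' -> k = k'.
Proof.
move=> [s [uniq_s [<- sX]]] [s' [uniq_s' [<- s'X]]].
apply/eqP; rewrite -uniq_size_uniq// => x.
by apply/idP/idP => [/s'X/sX|/sX/s'X].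
Qed.

(** * Right neighborhoods of 0 *)

Definition lex_pos (F : numDomainType) (s t : F) :=
  (0 < s) || (s == 0) && (0 < t).

Section RightNeighborhood.
Variable F : realFieldType.
Implicit Types s t : F.

Lemma near_right0_ex (Q : F -> Prop) :
  (\forall e \near 0^'+, Q e) -> exists2 e, 0 < e & Q e.
Proof. by move=> /(filterI (nbhs_right_gt 0))/filter_ex[e []]; exists e. Qed.

Lemma near_right0_gt0 s t : 0 < s -> \forall e \near 0^'+, 0 < s + e * t.
Proof.
move=> s0; have t1 : 0 < `|t| + 1 by rewrite ltr_wpDl.
have lt_e : \forall e \near 0^'+, e < s / (`|t| + 1).
  by apply: nbhs_right_lt; rewrite divr_gt0.
apply: filterS2 (nbhs_right_gt 0) lt_e => e e0; rewrite ltr_pdivlMr// => es.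
have : e * - t <= e * `|t| by rewrite ler_wpM2l ?ler_normr ?lexx ?orbT// ltW.
by lra.
Qed.

Lemma near_right0_lex_pos s t :
  \forall e \near 0^'+, (0 < s + e * t) = lex_pos s t.
Proof.
rewrite /lex_pos; have [s0|s0|->] := ltgtP s 0.
- have := near_right0_gt0 (- t) (_ : 0 < - s); rewrite oppr_gt0 => /(_ s0).
  by apply: filterS => e se; apply/negP => ?; lra.
- by apply: filterS (near_right0_gt0 t s0) => e ->.
- by apply: filterS (nbhs_right_gt 0) => e e0; rewrite add0r pmulr_rgt0.
Qed.

Lemma near_right0_neq0 s t : (s != 0) || (t != 0) ->
  \forall e \near 0^'+, s + e * t != 0.
Proof.
move=> st0; apply: filterS2 (near_right0_lex_pos s t)
  (near_right0_lex_pos (- s) (- t)) => e st Nst.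
apply/eqP => e0; move: st Nst; rewrite mulrN -opprD e0 oppr0 ltxx /lex_pos.
by rewrite oppr_eq0 !oppr_gt0; case: ltgtP st0 => //= _; case: ltgtP.
Qed.

End RightNeighborhood.

Section SmallVectors.
Variable R : realType.
Notation vec := 'rV[R]_3.
Implicit Types (p q : vec) (s : R).

Lemma near_right0_ball_gt0 s p : 0 < s ->
  \forall e \near 0^'+, forall z, dot z z < e -> 0 < s + dot z p.
Proof.
move=> s0; have p1 : 0 < dot p p + 1 by rewrite ltr_wpDl ?dot_ge0.
have lt_e : \forall e \near 0^'+, e < s ^+ 2 / (dot p p + 1).
  by apply: nbhs_right_lt; rewrite divr_gt0// exprn_gt0.
apply: filterS2 (nbhs_right_gt 0) lt_e => e e0.
rewrite ltr_pdivlMr// => es z ze; rewrite ltNge; apply/negP => szp.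
have : s ^+ 2 <= dot z p ^+ 2.
  by rewrite -(sqrrN (dot z p)) lerXn2r ?nnegrE; lra.
by have := cauchy_schwarz z p; have := dot_ge0 p; have := dot_ge0 z; nra.
Qed.

Lemma near_right0_ray (Q : vec -> Prop) p :
  (\forall e \near 0^'+, forall z, dot z z < e -> Q z) ->
  \forall t \near 0^'+, Q (t *: p).
Proof.
move=> /near_right0_ex[e e0 Qe].
have lt1 : \forall t \near (0 : R)^'+, t < 1 by exact: nbhs_right_lt.
apply: filterS3 (nbhs_right_gt 0) lt1 (near_right0_gt0 (- dot p p) e0).
by move=> t t0 t1 te; apply: Qe; rewrite dotZl dotZr; have := dot_ge0 p; nra.
Qed.

Lemma exists_nonorthogonal (Y : seq vec) : {in Y, forall y, y != 0} ->
  exists g, {in Y, forall y, dot g y != 0}.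
Proof.
elim: Y => [|y Y IH] Y0; first by exists 0.
have [|g gY] := IH; first by move=> z zY; apply: Y0; rewrite inE zY orbT.
suff /near_right0_ex[e _ ge] :
    \forall e \near 0^'+, {in y :: Y, forall z, dot g z + e * dot y z != 0}.
  by exists (g + e *: y) => z zY; rewrite dotDl dotZl ge.
apply: filter_in_seq => z /predU1P[->|zY]; apply: near_right0_neq0.
  by rewrite dot_eq0 Y0 ?mem_head ?orbT.
by rewrite gY.
Qed.

End SmallVectors.

(** * Convexity *)

Section ConvexSets.
Variables (F : realFieldType) (M : lmodType F).
Notation convex := (@convex_set F M).
Implicit Types (K : set M) (s t : F).

Lemma convex_set_comb K x y t : convex K -> 0 < t < 1 ->
  K x -> K y -> K (t *: x + (1 - t) *: y).
Proof.
move=> cK /andP[t0 t1] Kx Ky.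
by have := cK x y (Itv01 (ltW t0) (ltW t1)); rewrite !inE; exact.
Qed.

Lemma comb_convex_set K :
  (forall x y t, 0 < t < 1 -> K x -> K y -> K (t *: x + (1 - t) *: y)) ->
  convex K.
Proof.
move=> cK; apply/convex_setW => x y; rewrite !inE => Kx Ky t t0 t1; rewrite inE.
by apply: cK; rewrite // t0.
Qed.

Lemma convex_set1 (a : M) : convex [set a].
Proof.
apply: comb_convex_set => x y t _ -> ->.
by rewrite -scalerDl addrC subrK scale1r.
Qed.

Lemma convex_set_sum K n (p : 'I_n -> M) (w : 'I_n -> F) : convex K ->
  (forall i, K (p i)) -> (forall i, 0 <= w i) -> \sum_i w i = 1 ->
  K (\sum_i w i *: p i).
Proof.
move=> cK; elim: n p w => [|n IH] p w Kp w0.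
  by rewrite big_ord0 => /eqP; rewrite eq_sym oner_eq0.
rewrite !big_ord_recl => w1; set wr := \sum_(i < n) _ in w1.
have wr_ge0 : 0 <= wr by exact: sumr_ge0.
have [wr0|wr_neq0] := eqVneq wr 0.
  have w_lift0 i : w (lift ord0 i) = 0.
    by apply: (psumr_eq0P _ wr0) => // j _; exact: w0.
  rewrite big1 => [|i _]; last by rewrite w_lift0 scale0r.
  by move: w1; rewrite wr0 !addr0 => ->; rewrite scale1r.
have -> : \sum_(i < n) w (lift ord0 i) *: p (lift ord0 i) =
    (1 - w ord0) *: (\sum_(i < n) (w (lift ord0 i) / wr) *: p (lift ord0 i)).
  rewrite scaler_sumr -w1 addrAC subrr add0r; apply: eq_bigr => i _.
  by rewrite scalerA mulrCA mulfV ?mulr1.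
have w_le1 : w ord0 <= 1 by rewrite -w1 lerDl.
have := cK (p ord0) (\sum_(i < n) (w (lift ord0 i) / wr) *: p (lift ord0 i))
  (Itv01 (w0 ord0) w_le1).
rewrite !inE; apply=> //; apply: IH => [i|i|]; first exact: Kp.
  by rewrite divr_ge0.
by rewrite -mulr_suml mulfV.
Qed.

Lemma convex_comb_max s s' m t : 0 < t < 1 -> s <= m -> s' <= m ->
  m = t * s + (1 - t) * s' -> s = m /\ s' = m.
Proof.
rewrite -(subr_gt0 t) => /andP[t0 t1] sm sm' e.
have ts : 0 <= t * (m - s) by rewrite mulr_ge0 ?(ltW t0) ?subr_ge0.
have ts' : 0 <= (1 - t) * (m - s') by rewrite mulr_ge0 ?(ltW t1) ?subr_ge0.
have /eqP : t * (m - s) = 0 by lra.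
have /eqP : (1 - t) * (m - s') = 0 by lra.
by rewrite !mulf_eq0 (gt_eqF t0) (gt_eqF t1) !subr_eq0 => /eqP<- /eqP<-.
Qed.

End ConvexSets.

Section ConvexHulls.
Variable R : realType.
Notation vec := 'rV[R]_3.
Notation convex := (@convex_set R vec).
Implicit Types (a l p q u v w x y : vec) (s t : R).
Implicit Types (K : set vec) (V T : seq vec).

Lemma mem_conv V v : v \in V -> conv V v.
Proof.
move=> vV; pose j := Ordinal (etrans (index_mem v V) vV).
exists (fun i => (i == j)%:R); split=> [i|]; first by rewrite ler0n.
split; rewrite (bigD1 j)//= eqxx big1 ?addr0//.
- by move=> i /negPf->.
- by rewrite scale1r nth_index.
- by move=> i /negPf->; rewrite scale0r.
Qed.

Lemma convex_conv V : convex (conv V).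
Proof.
apply: comb_convex_set => x y t /andP[t0 t1] [w [w0 [w1 ->]]] [z [z0 [z1 ->]]].
exists (fun i => t * w i + (1 - t) * z i); split=> [i|].
  by rewrite addr_ge0// mulr_ge0// ?subr_ge0 ltW.
split; first by rewrite big_split/= -!mulr_sumr w1 z1; ring.
rewrite !scaler_sumr -big_split/=; apply: eq_bigr => i _.
by rewrite !scalerA -scalerDl.
Qed.

Lemma conv_min K V : convex K -> {in V, forall v, K v} -> conv V `<=` K.
Proof.
move=> cK VK x [w [w0 [w1 ->]]]; apply: convex_set_sum => // i.
by apply: VK; rewrite mem_nth.
Qed.

Lemma conv_sub V T : {subset V <= T} -> conv V `<=` conv T.
Proof. by move=> VT; apply: conv_min (@convex_conv T) _ => v /VT/mem_conv. Qed.

Lemma conv_image (f : {linear vec -> vec}) V :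
  f @` conv V = conv [seq f v | v <- V].
Proof.
apply/seteqP; split=> [_ [x Vx <-]|].
  move: x Vx; apply: conv_min => [|v vV]; last exact/mem_conv/map_f.
  apply: comb_convex_set => x y t t01 fx fy.
  rewrite /= linearD !linearZ.
  exact: convex_set_comb (@convex_conv _) t01 fx fy.
apply: conv_min => [|_ /mapP[v vV ->]]; last by exists v => //; exact: mem_conv.
apply: comb_convex_set => _ _ t t01 [x Vx <-] [y Vy <-].
exists (t *: x + (1 - t) *: y); last by rewrite linearD !linearZ.
exact: convex_set_comb (@convex_conv V) t01 Vx Vy.
Qed.

Lemma convex_halfspace w t : convex [set x | dot w x <= t].
Proof.
apply: comb_convex_set => x y s /= /andP[s0 s1] xt yt.
by rewrite dotDr !dotZr; nra.
Qed.

Lemma convex_plane w t : convex [set x | dot w x = t].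
Proof.
by apply: comb_convex_set => x y s _ /= xt yt; rewrite dotDr !dotZr xt yt; ring.
Qed.

Lemma convex_line a l : convex [set x | cross l (x - a) = 0].
Proof.
apply: comb_convex_set => x y t _ /= lx ly.
have -> : cross l (t *: x + (1 - t) *: y - a) =
    t *: cross l (x - a) + (1 - t) *: cross l (y - a) by vector_ring.
by rewrite lx ly !scaler0 addr0.
Qed.

Lemma dot_conv_le V w t :
  {in V, forall v, dot w v <= t} -> forall x, conv V x -> dot w x <= t.
Proof. by move=> Vt x; exact: (conv_min (@convex_halfspace w t)). Qed.

Lemma conv_face_sub V w t K : convex K ->
  {in V, forall v, dot w v < t \/ dot w v = t /\ K v} ->
  forall x, conv V x -> dot w x <= t /\ (dot w x = t -> K x).
Proof.
move=> cK VK x Vx; suff [lt_t|[-> Kx]] : dot w x < t \/ dot w x = t /\ K x.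
- by split; [exact: ltW|move=> e; rewrite e ltxx in lt_t].
- by [].
move: x Vx; apply: (@conv_min [set x | _ \/ _]) => //.
apply: comb_convex_set => x y s s01 /= xK yK; have /andP[s0 s1] := s01.
rewrite dotDr !dotZr.
case: xK yK => [xt|[xt Kx]] [yt|[yt Ky]]; try by left; nra.
by right; split; [rewrite xt yt; ring|exact: convex_set_comb].
Qed.

Lemma exists_positive_on_cons y T w p : {in T, forall x, 0 < dot w x} ->
  dot w y = 0 -> 0 < dot p y ->
  exists w', {in y :: T, forall x, 0 < dot w' x}.
Proof.
move=> wT wy py.
have /near_right0_ex[e e0 we] :
    \forall e \near 0^'+, {in T, forall x, 0 < dot w x + e * dot p x}.
  by apply: filter_in_seq => x xT; exact/near_right0_gt0/wT.
exists (w + e *: p) => x; rewrite dotDl dotZl => /predU1P[->|/we//].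
by rewrite wy add0r mulr_gt0.
Qed.

(* In the inductive step the vectors of the tail are moved along the segments
   towards the new vector [y] into the hyperplane orthogonal to [w], where the
   induction hypothesis applies again. *)
Lemma gordan T :
  conv T 0 \/ exists w, {in T, forall x, 0 < dot w x}.
Proof.
move: {2}(size T) (erefl (size T)) => n; elim: n T => [|n IH] [|y T]//=.
  by right; exists 0.
case=> sizeT; have sub_cons : conv T `<=` conv (y :: T).
  by apply: conv_sub => x xT; rewrite inE xT orbT.
have conv_y : conv (y :: T) y by apply: mem_conv; rewrite mem_head.
have [/sub_cons|[w wT]] := IH T sizeT; first by left.
have [->|y0] := eqVneq y 0; first by left; apply: mem_conv; rewrite mem_head.
have [wy|wy|wy] := ltgtP (dot w y) 0; last first.
- by right; apply: (exists_positive_on_cons (p := y) wT wy); rewrite dot_gt0.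
- by right; exists w => x /predU1P[->|/wT].
pose t x := - dot w y / (dot w x - dot w y).
have t01 x : x \in T -> 0 < t x < 1.
  by move=> /wT wx; rewrite divr_gt0 ?ltr_pdivrMr; lra.
have [conv0|[z zT]] :=
    IH [seq t x *: x + (1 - t x) *: y | x <- T] (etrans (size_map _ _) sizeT).
  left; apply: conv_min conv0 => [|_ /mapP[x xT ->]]; first exact: convex_conv.
  apply: convex_set_comb (@convex_conv (y :: T)) (t01 x xT) _ conv_y.
  exact/sub_cons/mem_conv.
pose z' := z - (dot z y / dot w y) *: w.
right; apply: (@exists_positive_on_cons y T z' (- w)).
- move=> x xT; have /= := zT _ (map_f _ xT); have /andP[tx0 _] := t01 x xT.
  rewrite -(pmulr_rgt0 (dot z' x) tx0); congr (0 < _); have wx := wT x xT.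
  rewrite /t /z' dotBl dotDr !dotZr dotZl; field.
  by rewrite lt_eqF//= subr_eq0 gt_eqF// (lt_trans wy).
- by rewrite /z' dotBl dotZl divfK ?subrr// lt_eqF.
- by rewrite dotNl oppr_gt0.
Qed.

Lemma separation T q :
  conv T q \/ exists w, {in T, forall x, dot w x < dot w q}.
Proof.
have [conv0|[w wT]] := gordan [seq q - x | x <- T].
  left; suff : [set z | conv T (q - z)] 0 by rewrite /= subr0.
  apply: conv_min conv0 => [|_ /mapP[x xT ->]]; last first.
    by rewrite /= subKr; exact: mem_conv.
  apply: comb_convex_set => x y t t01 /= Tx Ty.
  have -> : q - (t *: x + (1 - t) *: y) = t *: (q - x) + (1 - t) *: (q - y).
    vector_ring.
  exact: convex_set_comb (@convex_conv T) t01 Tx Ty.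
by right; exists w => x xT; have := wT _ (map_f _ xT); rewrite dotBr subr_gt0.
Qed.

Definition unique_max V w a := {in V, forall x, x != a -> dot w x < dot w a}.

Lemma conv_unique_max V w a : unique_max V w a ->
  forall x, conv V x -> dot w x <= dot w a /\ (dot w x = dot w a -> x = a).
Proof.
move=> max_a; apply: (conv_face_sub (@convex_set1 _ _ a)) => x xV.
by have [->|xa] := eqVneq x a; [right|left; exact: max_a].
Qed.

Lemma extreme_convP V a :
  extreme (conv V) a <-> a \in V /\ exists w, unique_max V w a.
Proof.
split=> [[Va ext]|[aV [w max_a]]]; last first.
  split=> [|x y t Vx Vy t01 e]; first exact: mem_conv.
  have [le_x eq_x] := conv_unique_max max_a Vx.
  have [le_y eq_y] := conv_unique_max max_a Vy.
  have := congr1 (dot w) e; rewrite dotDr !dotZr.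
  by case/(convex_comb_max t01 le_x le_y) => /eq_x -> /eq_y ->.
have cVa : convex [set x | conv V x /\ x <> a].
  apply: comb_convex_set => x y t t01 [Vx xa] [Vy ya]; split.
    exact: convex_set_comb (@convex_conv V) t01 Vx Vy.
  move=> /esym e; apply: xa; have xy := ext x y t Vx Vy t01 e.
  by rewrite e -xy -scalerDl addrC subrK scale1r.
have not_conv T : {in T, forall v, v \in V /\ v != a} -> ~ conv T a.
  move=> TVa Ta; have [] // : [set x | conv V x /\ x <> a] a.
  apply: conv_min cVa _ _ Ta => v /TVa[vV /eqP va].
  by split=> //; exact: mem_conv.
split.
  apply: contrapT => aV; apply: (not_conv V) Va => v vV; split=> //.
  by apply: contra_notN aV => /eqP <-.
have [/not_conv[]|[w wa]] := separation [seq x <- V | x != a] a.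
  by move=> v; rewrite mem_filter => /andP[].
by exists w => x xV xa; apply: wa; rewrite mem_filter xa.
Qed.

Definition all_exposed V := {in V, forall a, exists w, unique_max V w a}.

Lemma exists_vertex_seq V :
  exists S, [/\ uniq S, conv V = conv S & all_exposed S].
Proof.
move: {2}(size V) (leqnn (size V)) => n; elim: n V => [|n IH] V sizeV.
  by exists V; case: V sizeV => //= _; split.
have [exposed|] := pselect (all_exposed V).
  exists (undup V); split; first exact: undup_uniq.
    by apply/seteqP; split; apply: conv_sub => v; rewrite mem_undup.
  move=> a; rewrite mem_undup => /exposed[w max_a]; exists w => x.
  by rewrite mem_undup; exact: max_a.
move=> /existsNP[a /not_implyP[aV not_exposed]].
have [conv_a|[w wa]] := separation [seq x <- V | x != a] a; last first.
  case: not_exposed; exists w => x xV xa.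
  by apply: wa; rewrite mem_filter xa.
have [|S [uniq_S conv_S exposed_S]] := IH [seq x <- V | x != a].
  rewrite -ltnS (leq_trans _ sizeV)// size_filter ltn_neqAle -all_count.
  by rewrite count_size andbT; apply/allPn; exists a; rewrite ?negbK.
exists S; split=> //; rewrite -conv_S; apply/seteqP; split.
  apply: conv_min => [|v vV]; first exact: convex_conv.
  have [->//|va] := eqVneq v a.
  by apply: mem_conv; rewrite mem_filter va.
by apply: conv_sub => v; rewrite mem_filter => /andP[].
Qed.

End ConvexHulls.

(** * Affine dimension *)

Section Dimension.
Variable R : realType.
Notation vec := 'rV[R]_3.
Implicit Types (a b n p q v w : vec) (t : R) (X : set vec).

Lemma aff_add_scale_sub X w p q t : X w -> X p -> X q ->
  aff X (w + t *: (p - q)).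
Proof.
move=> Xw Xp Xq; exists 3, (fun i : 'I_3 => [:: w; p; q]`_i).
exists (fun i : 'I_3 => [:: 1; t; - t]`_i); split; first by case=> [[|[|[|]]]].
split; rewrite !big_ord_recl big_ord0 /=; first by ring.
by rewrite scale1r addr0 scalerBr scaleNr.
Qed.

Lemma dim_ge1 X a b : X a -> X b -> a != b -> dim_ge X 1.
Proof.
move=> Xa Xb ab; exists a, (fun=> b); split=> //; split=> //.
apply: inj_row_free => z; rewrite mulmx_sum_row big_ord1 rowK => /eqP.
rewrite scaler_eq0 subr_eq0 [b == a]eq_sym (negPf ab) orbF => /eqP z0.
by apply/rowP => i; rewrite ord1 z0 mxE.
Qed.

Lemma row_free_cross (M : 'M[R]_(2, 3)) :
  row_free M = (cross (row 0 M) (row 1 M) != 0).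
Proof.
have comb (z : 'rV_2) : z *m M = z 0 0 *: row 0 M + z 0 1 *: row 1 M.
  rewrite mulmx_sum_row !big_ord_recl big_ord0 addr0.
  by rewrite (_ : lift ord0 ord0 = 1); [|exact: val_inj].
apply/idP/idP => [free_M|]; last first.
  move: (row 0 M) (row 1 M) comb => p q comb pq0.
  apply: inj_row_free => z; rewrite comb => zM.
  have /eqP := congr1 (fun x => cross x q) zM.
  rewrite crossDl !crossZl crossvv cross0l scaler0 addr0 scaler_eq0.
  rewrite (negPf pq0) orbF => /eqP z0.
  have /eqP := congr1 (cross p) zM.
  rewrite crossDr !crossZr crossvv cross0r scaler0 add0r scaler_eq0.
  rewrite (negPf pq0) orbF => /eqP z1.
  apply/rowP => i; rewrite mxE; case: (unliftP 0 i) => [j ->|->//].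
  by rewrite [j]ord1 -[RHS]z1; congr (z _ _); exact: val_inj.
have free (z : 'rV_2) : z *m M = 0 -> z = 0.
  by move=> /eqP; rewrite mulmx_free_eq0// => /eqP.
apply/eqP => cross0; have [row0|row0] := eqVneq (row 0 M) 0.
  have /free/rowP/(_ 0) : (delta_mx 0 0 : 'rV_2) *m M = 0 by rewrite -rowE.
  by rewrite !mxE => /eqP; rewrite oner_eq0.
have [t row1] := (cross_eq0P row0).1 cross0.
have /free/rowP/(_ 1) : (\row_(i < 2) if i == 0 then t else -1) *m M = 0.
  by rewrite comb !mxE /= row1 scaleN1r subrr.
by rewrite !mxE => /eqP; rewrite oppr_eq0 oner_eq0.
Qed.

Lemma dim_ge2P X : dim_ge X 2 <->
  exists a b v, [/\ X a, X b, X v & cross (b - a) (v - a) != 0].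
Proof.
split=> [[a [p [Xa [Xp]]]]|[a [b [v [Xa Xb Xv abv]]]]].
  by rewrite row_free_cross !rowK; exists a, (p 0), (p 1).
exists a, (fun i : 'I_2 => if i == 0 then b else v); split=> //.
by split=> [i|]; [case: ifP|rewrite row_free_cross !rowK].
Qed.

Lemma dim_ge3_not_in_plane X n t : dim_ge X 3 -> n != 0 ->
  ~ (forall x, X x -> dot n x = t).
Proof.
move=> [p0 [p [X0 [Xp free_p]]]] /eqP n0 Xt; apply: n0.
apply: (can_inj trmxK); rewrite trmx0.
have unit_p : \matrix_i (p i - p0) \in unitmx by rewrite -row_free_unit.
rewrite -[n^T](mulKmx unit_p).
suff -> : \matrix_i (p i - p0) *m n^T = 0 by rewrite mulmx0.
apply/matrixP => i j; rewrite [j]ord1 !mxE.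
transitivity (dot (p i - p0) n); last by rewrite dotC dotBr !Xt ?subrr.
by apply: eq_bigr => k _; rewrite !mxE.
Qed.

End Dimension.

(** * Faces of a polytope given by its vertices *)

Definition nonplanar (R : realType) (V : seq 'rV[R]_3) :=
  forall n t, n != 0 -> exists2 x, x \in V & dot n x != t.

Lemma dim_ge3_nonplanar (R : realType) (V : seq 'rV[R]_3) :
  dim_ge (conv V) 3 -> nonplanar V.
Proof.
move=> dim3 n t n0; apply: contrapT => planar.
apply: (dim_ge3_not_in_plane dim3 n0 (t := t)).
apply: (conv_min (@convex_plane _ n t)) => x xV; apply: contrapT => /eqP nx.
by apply: planar; exists x.
Qed.

Section Polytope.
Variable R : realType.
Notation vec := 'rV[R]_3.
Notation convex := (@convex_set R vec).
Implicit Types (a b c d l m n p q u v w x y : vec) (s t : R) (K : set vec).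
Variable S : seq vec.
Hypotheses (uniq_S : uniq S) (exposed_S : all_exposed S).
Hypothesis nonplanar_S : nonplanar S.

Notation P := (conv S).

Definition others a b := [seq x <- S | (x != a) && (x != b)].

Definition supports c a := {in S, forall x, dot c x <= dot c a}.

Definition edge_at m a b := [&& a \in S, b \in S, a != b, dot m b == dot m a &
  all (fun x => dot m x < dot m a) (others a b)].

(* For [n = 0] this holds for any three vertices: the face is all of [P]. *)
Definition facet_at n a b v :=
  [/\ a \in S, b \in S, v \in others a b, a != b &
      [/\ supports n a, dot n b = dot n a & dot n v = dot n a]].

Definition face c : set vec :=
  [set x | P x /\ forall y, P y -> dot c y <= dot c x].

Definition generic d := forall F, is_facet P F -> ~ plane_orth_facet d F.

Lemma othersE x a b : (x \in others a b) = [&& x != a, x != b & x \in S].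
Proof. by rewrite mem_filter andbA. Qed.

Lemma others_sub a b : {subset others a b <= S}.
Proof. by move=> x; rewrite othersE => /and3P[]. Qed.

Lemma others_cases a b x : x \in S -> [\/ x = a, x = b | x \in others a b].
Proof.
move=> xS; rewrite othersE xS andbT.
have [->|xa] := eqVneq x a; first by constructor 1.
by have [->|xb] := eqVneq x b; [constructor 2|constructor 3].
Qed.

Lemma others_neq_nil a b : others a b != [::].
Proof.
have [n n0 nba] := exists_orthogonal (b - a).
have [x xS nx] := nonplanar_S (dot n a) n0.
suff : x \in others a b by apply: contraTneq => ->.
rewrite othersE xS andbT; apply/andP.
by split; apply: contra_neq nx => ->//; exact/dot_eq_sub.
Qed.

Lemma edge_atP m a b : reflect
  [/\ a \in S, b \in S, a != b, dot m b = dot m a &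
      {in others a b, forall x, dot m x < dot m a}]
  (edge_at m a b).
Proof.
apply: (iffP and5P) => -[aS bS ab /eqP mb /allP m_lt]; split=> //; exact/eqP.
Qed.

Arguments edge_atP {m a b}.

Lemma edge_atC m a b : edge_at m a b = edge_at m b a.
Proof.
suff edge_sym p q : edge_at m p q -> edge_at m q p.
  by apply/idP/idP; exact: edge_sym.
move=> /edge_atP[pS qS pq mq m_lt].
apply/edge_atP; split; rewrite // 1?eq_sym//.
by move=> x; rewrite mq othersE andbCA -othersE; exact: m_lt.
Qed.

Lemma edge_at_supports m a b : edge_at m a b -> supports m a.
Proof.
move=> /edge_atP[_ _ _ mb m_lt] x /(others_cases a b)[->//|->|/m_lt/ltW//].
by rewrite mb.
Qed.

Lemma edge_at_sub_neq0 m a b : edge_at m a b -> b - a != 0.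
Proof. by case/edge_atP=> _ _ ab _ _; rewrite subr_eq0 eq_sym. Qed.

Lemma edge_at_neq0 m a b : edge_at m a b -> m != 0.
Proof.
move=> /edge_atP[_ _ _ _ m_lt]; have := others_neq_nil a b.
case: others m_lt => // x s /(_ x (mem_head x s)) mx _.
by apply: contraTneq mx => ->; rewrite !dot0l ltxx.
Qed.

(* A linear function is never uniquely maximal at the middle one of three
   collinear points. *)
Lemma noncollinear a b v : a \in S -> b \in S -> v \in others a b -> a != b ->
  cross (b - a) (v - a) != 0.
Proof.
rewrite othersE => aS bS /and3P[va vb vS] ab; apply/eqP.
have ba0 : b - a != 0 by rewrite subr_eq0 eq_sym.
move=> /(cross_eq0P ba0)[t et].
have dot_v w : dot w v - dot w a = t * (dot w b - dot w a).
  by rewrite -!dotBr et dotZr.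
have [t0|t0|t0] := ltgtP t 0.
- have [w max_a] := exposed_S aS.
  have := max_a b bS; have := max_a v vS va; have := dot_v w.
  by rewrite eq_sym ab => ? ? /(_ isT); nra.
- have [t1|t1|t1] := ltgtP t 1.
  + have [w max_v] := exposed_S vS.
    have := max_v a aS; have := max_v b bS; have := dot_v w.
    by rewrite ![_ == v]eq_sym va vb => ? /(_ isT) ? /(_ isT); nra.
  + have [w max_b] := exposed_S bS.
    by have := max_b a aS ab; have := max_b v vS vb; have := dot_v w; nra.
  + by move/eqP: vb; apply; move: et; rewrite t1 scale1r => /addIr.
- by move/eqP: va; apply; apply/eqP; rewrite -subr_eq0 et t0 scale0r.
Qed.

Lemma facet_at_noncollinear n a b v :
  facet_at n a b v -> cross (b - a) (v - a) != 0.
Proof. by case=> aS bS vab ab _; exact: noncollinear. Qed.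

Lemma facet_at_cross n a b v : facet_at n a b v ->
  exists t, n = t *: cross (b - a) (v - a).
Proof.
move=> fac; apply: orthogonal_cross (facet_at_noncollinear fac) _ _;
  by case: fac => _ _ _ _ [_ nb nv]; exact/dot_eq_sub.
Qed.

Lemma faceP c a x : a \in S -> supports c a ->
  face c x <-> P x /\ dot c x = dot c a.
Proof.
move=> aS max_a; have Pa := mem_conv aS; split=> -[Px cx].
  by split=> //; apply/eqP; rewrite eq_le cx// (dot_conv_le max_a).
by split=> // y; rewrite cx; exact: dot_conv_le.
Qed.

Arguments faceP {c a x}.

Lemma mem_face c a x : a \in S -> supports c a -> x \in S ->
  dot c x = dot c a -> face c x.
Proof.
move=> aS max_a xS cx; apply/(faceP aS max_a).
by split=> //; exact: mem_conv.
Qed.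

Lemma facet_at_face n a b v : facet_at n a b v ->
  [/\ face n a, face n b & face n v].
Proof.
move=> [aS bS vab _ [max_a nb nv]]; split; apply: (mem_face aS max_a) => //.
exact: others_sub vab.
Qed.

Lemma exists_supports c : exists2 a, a \in S & supports c a.
Proof.
apply: exists_seq_max; move: (others_neq_nil 0 0).
rewrite -!size_eq0 -!lt0n => /leq_trans; apply.
by rewrite size_filter count_size.
Qed.

Lemma supports_cases c a : a \in S -> supports c a ->
  [\/ unique_max S c a, exists b, edge_at c a b | exists b v, facet_at c a b v].
Proof.
move=> aS max_a.
have eq_max x : x \in S -> ~ dot c x < dot c a -> dot c x = dot c a.
  by move=> xS /negP; rewrite -leNgt => ac; apply/eqP; rewrite eq_le ac max_a.
have [|/existsNP[b /not_implyP[bS /not_implyP[ba /eq_max cb]]]] :=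
  pselect (unique_max S c a); first by constructor 1.
rewrite eq_sym in ba.
have [m_lt|] := pselect {in others a b, forall x, dot c x < dot c a}.
  by constructor 2; exists b; apply/edge_atP; split=> //; exact: cb.
move=> /existsNP[v /not_implyP[vab /eq_max cv]].
constructor 3; exists b, v; split=> //; split=> //; first exact: cb.
exact/cv/others_sub/vab.
Qed.

(* Rotating the normal of an edge about the edge until it meets a further
   vertex produces the normal of a facet that contains the edge. *)
Lemma edge_at_rotate m a b q : edge_at m a b -> dot q b = dot q a ->
  exists t v, facet_at (q + t *: m) a b v.
Proof.
move=> /edge_atP[aS bS ab mb m_lt] qb.
have [|v vab max_v] := exists_max_ratio (fun x => dot q (x - a))
    (g := fun x => dot m a - dot m x) (others_neq_nil a b).
  by move=> x /m_lt; rewrite subr_gt0.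
have mv : 0 < dot m a - dot m v by rewrite subr_gt0 m_lt.
exists (dot q (v - a) / (dot m a - dot m v)), v; set t := _ / _.
have rot x : dot (q + t *: m) x - dot (q + t *: m) a =
    dot q (x - a) - t * (dot m a - dot m x).
  by rewrite !dotDl !dotZl dotBr; ring.
split=> //; split.
- move=> x /(others_cases a b)[->//|->|xab].
    by rewrite !dotDl !dotZl qb mb.
  rewrite -subr_le0 rot subr_le0 /t mulrAC ler_pdivlMr//; exact: max_v.
- by rewrite !dotDl !dotZl qb mb.
- by apply/eqP; rewrite -subr_eq0 rot /t divfK ?subrr// gt_eqF.
Qed.

Lemma facet_at_facet n a b v :
  n != 0 -> facet_at n a b v -> is_facet P (face n).
Proof.
move=> n0 fac; have [fa fb fv] := facet_at_face fac.
have [aS _ _ _ [max_a _ _]] := fac.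
split; first by exists n.
split.
  apply/dim_ge2P; exists a, b, v; split=> //.
  exact: facet_at_noncollinear fac.
move=> dim3; apply: (dim_ge3_not_in_plane (t := dot n a) dim3 n0).
by move=> x /(faceP aS max_a)[].
Qed.

Lemma generic_not_facet_at d n a b v : generic d -> n != 0 -> dot n d = 0 ->
  ~ facet_at n a b v.
Proof.
move=> gen_d n0 nd fac.
apply: (gen_d (face n)); first exact: facet_at_facet fac.
have [aS _ _ _ [max_a _ _]] := fac.
exists n; split=> //; split=> // x y.
move=> /(faceP aS max_a)[_ nx] /(faceP aS max_a)[_ ny].
by rewrite dotBr nx ny subrr.
Qed.

Lemma generic_edge d m a b : generic d -> edge_at m a b -> cross d (b - a) != 0.
Proof.
move=> gen_d em; have ba0 := edge_at_sub_neq0 em.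
apply/eqP => d_ba; pose q := cross (b - a) m.
have m_ba : dot m (b - a) = 0.
  by apply/dot_eq_sub; case/edge_atP: em.
have q0 : q != 0.
  apply: contra_neq (edge_at_neq0 em) => /(cross_eq0P ba0)[t mt].
  by apply/eqP; rewrite -dot_eq0 {2}mt dotZr m_ba mulr0.
have q_ba : dot q (b - a) = 0 by rewrite dotC dot_crossl.
have [t [v fac]] := edge_at_rotate em (dot_eq_sub.2 q_ba).
apply: (generic_not_facet_at gen_d _ _ fac).
  apply: contra_neq q0 => /(congr1 (dot q)).
  rewrite dotDr dotZr [dot q m]dotC dot_crossr mulr0 addr0 dot0r.
  by move=> /eqP; rewrite dot_eq0 => /eqP.
have [s ->] : exists s, d = s *: (b - a).
  by apply/(cross_eq0P ba0); rewrite crossC d_ba oppr0.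
by rewrite dotZr dotDl dotZl q_ba m_ba mulr0 addr0 mulr0.
Qed.

(** * The silhouette of a polytope *)

Definition orient d a b v := dot d (cross (b - a) (v - a)).

(* Seen along [d], the projections of all other vertices lie to the left of the
   line from [a] to [b]. *)
Definition silhouette_edge d a b := [&& a \in S, b \in S, a != b &
  all (fun v => 0 < orient d a b v) (others a b)].

Definition silhouette_vertex d a := exists2 w, dot w d = 0 & unique_max S w a.

Lemma silhouette_edgeP d a b : reflect
  [/\ a \in S, b \in S, a != b & {in others a b, forall v, 0 < orient d a b v}]
  (silhouette_edge d a b).
Proof. by apply: (iffP and4P) => -[aS bS ab /allP]. Qed.

Arguments silhouette_edgeP {d a b}.

Lemma silhouette_edge_inj d a b b' :
  silhouette_edge d a b -> silhouette_edge d a b' -> b = b'.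
Proof.
move=> /silhouette_edgeP[aS bS ab left_ab].
move=> /silhouette_edgeP[_ bS' ab' left_ab'].
apply/eqP/negP => /negP bb'.
have := left_ab b'; rewrite othersE bS' eq_sym ab' eq_sym bb' => /(_ isT).
have := left_ab' b; rewrite othersE bS eq_sym ab bb' => /(_ isT).
by rewrite /orient crossC dotNr; lra.
Qed.

Lemma silhouette_edge_vertex d a b :
  d != 0 -> silhouette_edge d a b -> silhouette_vertex d a.
Proof.
move=> d0 /silhouette_edgeP[_ _ _ left_ab]; set l := proj d (b - a).
have l_ba x : dot l (x - a) = dot l (proj d (x - a)).
  by rewrite dot_proj_id// dot_projd.
have l0 : l != 0.
  apply/eqP => l0; have d_ba : cross d (b - a) = 0.
    by rewrite -cross_proj -/l l0 cross0r.
  have := others_neq_nil a b.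
  case: others left_ab => // x s /(_ x (mem_head x s)).
  by rewrite /orient dot_cross d_ba dot0l ltxx.
suff /near_right0_ex[t t0 tP] : \forall t \near 0^'+,
    {in others a b, forall x, 0 < orient d a b x + t * dot l (x - a)}.
  (* The outer normal of [ab], tilted slightly so that [b] falls below [a]. *)
  exists (- (cross d (b - a) + t *: l)).
    by rewrite dotNl dotDl dotZl dot_projd// dotC dot_crossl mulr0 addr0 oppr0.
  move=> x xS xa.
  rewrite -subr_lt0 -dotBr dotNl oppr_lt0 dotDl dotZl -dot_cross.
  have [xa'|->|/tP//] := others_cases a b xS; first by rewrite xa' eqxx in xa.
  by rewrite crossvv dot0r add0r mulr_gt0// l_ba dot_gt0.
by apply: filter_in_seq => x /left_ab; exact: near_right0_gt0.
Qed.

Lemma generic_silhouette_edge d a b : generic d ->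
  a \in S -> b \in S -> a != b -> cross (b - a) d != 0 ->
  {in S, forall x, 0 <= orient d a b x} -> silhouette_edge d a b.
Proof.
move=> gen_d aS bS ab n0 orient_ge0; apply/silhouette_edgeP; split=> // x xab.
rewrite lt_neqAle orient_ge0 ?(others_sub xab)// andbT; apply/eqP => x0.
have nE y : dot (cross (b - a) d) y = dot (cross (b - a) d) a - orient d a b y.
  by rewrite /orient; vector_ring.
apply: (@generic_not_facet_at d (cross (b - a) d) a b x) => //.
  by rewrite dotC dot_crossr.
split=> //; split=> [y yS||].
- by rewrite [leLHS]nE gerBl orient_ge0.
- by rewrite nE /orient crossvv dot0r subr0.
- by rewrite nE -x0 subr0.
Qed.

(* Among the vertices seen from [a], the next one on the silhouette is the one
   of maximal slope with respect to the frame [(w, cross d w)]. *)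
Lemma silhouette_vertex_edge d a : d != 0 -> generic d -> a \in S ->
  silhouette_vertex d a -> exists b, silhouette_edge d a b.
Proof.
move=> d0 gen_d aS [w wd max_a]; pose q := cross d w.
have w_lt x : x \in others a a -> 0 < dot w a - dot w x.
  by rewrite othersE => /and3P[xa _ xS]; rewrite subr_gt0 max_a.
have [b b_oth slope_b] :=
  exists_max_ratio (fun x => dot q (x - a)) (others_neq_nil a a) w_lt.
have wb := w_lt b b_oth; move: b_oth; rewrite othersE => /and3P[ba _ bS].
have w0 : w != 0 by apply: contraTneq wb => ->; rewrite !dot0l subrr ltxx.
have slopeE x : dot w w * orient d a b x =
    (dot w a - dot w x) * dot q (b - a) - (dot w a - dot w b) * dot q (x - a).
  have wq : dot w w *: d = cross w q by rewrite cross_crossr wd scale0r subr0.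
  by rewrite /orient -dotZl wq; vector_ring.
exists b; apply: generic_silhouette_edge; rewrite // 1?eq_sym//.
  apply: contraTneq wb => ba_d; have [t et] : exists t, b - a = t *: d.
    by apply/(cross_eq0P d0); rewrite crossC -ba_d oppr0.
  by rewrite -dotBr -opprB et dotNr dotZr wd mulr0 oppr0 ltxx.
move=> x xS; have [->|xa] := eqVneq x a.
  by rewrite /orient subrr cross0r dot0r.
rewrite -(pmulr_rge0 _ (_ : 0 < dot w w)) ?dot_gt0// slopeE subr_ge0.
by rewrite mulrC [leRHS]mulrC; apply: slope_b; rewrite othersE xa.
Qed.

Lemma silhouette_vertex_extreme d a : a \in S -> silhouette_vertex d a ->
  extreme (proj d @` P) (proj d a).
Proof.
move=> aS [w wd max_a]; rewrite conv_image; apply/extreme_convP.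
split; first exact: map_f.
exists w => _ /mapP[x xS ->] ne; rewrite !dot_proj_id//.
by apply: max_a => //; apply: contra_neq ne => ->.
Qed.

Lemma silhouette_vertex_proj_inj d a b : b \in S -> silhouette_vertex d a ->
  proj d a = proj d b -> a = b.
Proof.
move=> bS [w wd max_a] pab; apply/eqP/negP => /negP; rewrite eq_sym.
move=> /(max_a b bS); rewrite -[dot w b](dot_proj_id _ wd) -pab.
by rewrite dot_proj_id ?ltxx.
Qed.

(* Two vertices with the same extreme projection span an edge or lie on a facet
   whose plane contains [d]. *)
Lemma extreme_silhouette_vertex d q : d != 0 -> generic d ->
  extreme (proj d @` P) q ->
  exists2 a, a \in S & silhouette_vertex d a /\ q = proj d a.
Proof.
move=> d0 gen_d; rewrite conv_image.
move=> /extreme_convP[/mapP[a aS ->] [w max_pa]]; exists a => //; split=> //.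
exists (proj d w); first exact: dot_projd.
have w_lt x : x \in S -> proj d x != proj d a ->
    dot (proj d w) x < dot (proj d w) a.
  by move=> xS; rewrite -!dot_proj; apply: max_pa; exact: map_f.
have w_eq x : proj d x = proj d a -> dot (proj d w) x = dot (proj d w) a.
  by rewrite -!dot_proj => ->.
have supp_a : supports (proj d w) a.
  move=> x xS.
  by have [/w_eq->//|/(w_lt x xS)/ltW] := eqVneq (proj d x) (proj d a).
have [//|[b em]|[b [v fac]]] := supports_cases aS supp_a; exfalso.
  have [_ bS _ wb _] := edge_atP em.
  have := generic_edge gen_d em; rewrite proj_inj_cross ?eqxx//.
  by apply/eqP; apply: contraT => /(w_lt b bS); rewrite wb ltxx.
apply: generic_not_facet_at gen_d _ (dot_projd w d0) fac.
apply/eqP => w0; have [n n0 nd] := exists_orthogonal d.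
have [x xS /eqP] := nonplanar_S (dot n a) n0; apply.
rewrite -(dot_proj_id x nd) -(dot_proj_id a nd); congr (dot n _); apply/eqP.
by apply: contraT => /(w_lt x xS); rewrite w0 !dot0l ltxx.
Qed.

Definition vertex_pairs := [seq (a, b) | a <- S, b <- S].

Lemma uniq_vertex_pairs : uniq vertex_pairs.
Proof. by apply: allpairs_uniq => // -[a b] [a' b'] _ _ []/= -> ->. Qed.

Lemma mem_vertex_pairs a b : ((a, b) \in vertex_pairs) = (a \in S) && (b \in S).
Proof.
apply/allpairsP/andP => [[[x y] /= [xS yS [-> ->]]] //|[aS bS]].
by exists (a, b).
Qed.

Definition silhouette_size d :=
  count (fun ab => silhouette_edge d ab.1 ab.2) vertex_pairs.

Lemma card_extreme_proj d : d != 0 -> generic d ->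
  card_eq (extreme (proj d @` P)) (silhouette_size d).
Proof.
move=> d0 gen_d.
pose T := [seq ab <- vertex_pairs | silhouette_edge d ab.1 ab.2].
have TP ab : ab \in T -> silhouette_edge d ab.1 ab.2.
  by rewrite mem_filter => /andP[].
exists [seq proj d ab.1 | ab <- T]; split.
  rewrite map_inj_in_uniq ?filter_uniq ?uniq_vertex_pairs//.
  move=> [a b] [a' b'] /TP/= ab /TP/= ab' paa'.
  have [aS' _ _ _] := silhouette_edgeP ab'.
  have sil_a := silhouette_edge_vertex d0 ab.
  have aa' := silhouette_vertex_proj_inj aS' sil_a paa'.
  by rewrite -aa' in ab' *; rewrite (silhouette_edge_inj ab ab').
split=> [|x]; first by rewrite size_map size_filter.
split=> [/mapP[z /TP ab ->]|].
  have [aS _ _ _] := silhouette_edgeP ab.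
  by apply: silhouette_vertex_extreme => //; exact: silhouette_edge_vertex ab.
move=> /(extreme_silhouette_vertex d0 gen_d)[a aS [sil_a ->]].
have [b ab] := silhouette_vertex_edge d0 gen_d aS sil_a.
apply/mapP; exists (a, b) => //; rewrite mem_filter ab mem_vertex_pairs aS.
by case/silhouette_edgeP: ab.
Qed.

(** * Normal cones and aggregated cones *)

Definition edge_cone a b w := dot w b = dot w a /\ supports w a.

Definition parallel_edge u a b :=
  cross u (b - a) = 0 /\ exists m, edge_at m a b.

Lemma edge_face_sub m a b K : edge_at m a b -> convex K -> K a -> K b ->
  face m `<=` K.
Proof.
move=> em cK Ka Kb x; have [aS _ _ mb m_lt] := edge_atP em.
move=> /(faceP aS (edge_at_supports em))[Px mx].
have [y yS|_ /(_ mx)//] := conv_face_sub (w := m) (t := dot m a) cK _ Px.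
by case: (others_cases a b yS) => [->|->|/m_lt]; [right|right|left].
Qed.

Lemma unique_max_face c a : a \in S -> unique_max S c a -> face c `<=` [set a].
Proof.
move=> aS max_a x [Px max_x]; have [ca eq_a] := conv_unique_max max_a Px.
by apply/eq_a/eqP; rewrite eq_le ca max_x//; exact: mem_conv.
Qed.

Lemma edge_face_parallel m a b x y : edge_at m a b -> face m x -> face m y ->
  cross (b - a) (y - x) = 0.
Proof.
move=> em; have line := edge_face_sub em (@convex_line _ a (b - a)).
move=> /line lx /line ly; apply: (@cross_sub_base _ _ a); [apply: lx|apply: ly];
  by rewrite /= ?crossvv ?subrr ?cross0r.
Qed.

Lemma dim_ge2_face c : dim_ge (face c) 2 -> exists a b v, facet_at c a b v.
Proof.
move=> /dim_ge2P[x [y [z [fx fy fz xyz]]]].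
have [a aS max_a] := exists_supports c.
have [max1|[b em]|[b [v fac]]] := supports_cases aS max_a.
- have /= xa := unique_max_face aS max1 fx.
  have /= ya := unique_max_face aS max1 fy.
  by move: xyz; rewrite xa ya subrr cross0l eqxx.
- move: xyz; rewrite (cross_eq0_trans (edge_at_sub_neq0 em)) ?eqxx//;
    exact: edge_face_parallel em _ _.
- by exists a, b, v.
Qed.

Lemma edge_at_face m a b : edge_at m a b -> face m a /\ face m b.
Proof.
move=> em; have [aS bS _ mb _] := edge_atP em.
by split; exact: (mem_face aS (edge_at_supports em)).
Qed.

Lemma edge_at_cone m a b : edge_at m a b -> edge_cone a b m.
Proof. by move=> em; split; [case/edge_atP: em|exact: edge_at_supports em]. Qed.

Lemma edge_cone0 a b : edge_cone a b 0.
Proof. by split=> [|x _]; rewrite !dot0l. Qed.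

Lemma ncone_edgeP m a b w : edge_at m a b ->
  ncone P (face m) w <-> edge_cone a b w.
Proof.
move=> em; have [aS bS _ _ _] := edge_atP em.
have [fa fb] := edge_at_face em.
split=> [nw|[wb max_a] x y Px fy].
  split; last by move=> x xS; apply: nw => //; exact: mem_conv.
  by apply/eqP; rewrite eq_le !nw//; exact: mem_conv.
rewrite (edge_face_sub em (@convex_plane _ w (dot w a)) _ wb fy)//.
exact: dot_conv_le Px.
Qed.

Arguments ncone_edgeP {m a b w}.

Lemma edge_cone_ball m a b : edge_at m a b ->
  \forall e \near 0^'+, forall z, dot z z < e -> dot z b = dot z a ->
    edge_cone a b (m + z).
Proof.
move=> em; have [_ _ _ mb m_lt] := edge_atP em.
have : \forall e \near 0^'+, {in others a b, forall x, forall z, dot z z < e ->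
    0 < (dot m a - dot m x) + dot z (a - x)}.
  apply: filter_in_seq => x /m_lt mx.
  by apply: near_right0_ball_gt0; rewrite subr_gt0.
apply: filterS => e small z ze zb; split; first by rewrite !dotDl mb zb.
move=> x /(others_cases a b)[->//|->|xab]; first by rewrite !dotDl mb zb.
by have := small x xab z ze; rewrite !dotDl dotBr; lra.
Qed.

Lemma edge_cone_ray m a b q : edge_at m a b -> dot q b = dot q a ->
  \forall e \near 0^'+, edge_cone a b (m + e *: q).
Proof.
move=> em qb; have := near_right0_ray q (edge_cone_ball em).
by apply: filterS => e; apply; rewrite !dotZl qb.
Qed.

Lemma edge_coneD a b w w' e : 0 <= e -> edge_cone a b w -> edge_cone a b w' ->
  edge_cone a b (w + e *: w').
Proof.
move=> e0 [wb max_w] [wb' max_w']; split; first by rewrite !dotDl !dotZl wb wb'.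
by move=> x xS; rewrite !dotDl !dotZl lerD ?max_w// ler_wpM2l ?max_w'.
Qed.

Lemma ncone_edge_dim m a b : edge_at m a b -> dim_eq (ncone P (face m)) 2.
Proof.
move=> em; have ba0 := edge_at_sub_neq0 em.
have m_ba : dot m (b - a) = 0 by apply/dot_eq_sub; case/edge_atP: em.
split; last first.
  move=> dim3; apply: (dim_ge3_not_in_plane (t := 0) dim3 ba0) => w.
  by move=> /(ncone_edgeP em)[wb _]; rewrite dotC; exact/dot_eq_sub.
have q_b : dot (cross (b - a) m) b = dot (cross (b - a) m) a.
  by apply/dot_eq_sub; rewrite dotC dot_crossl.
have [e e0 cone_e] := near_right0_ex (edge_cone_ray em q_b).
apply/dim_ge2P; exists 0, m, (m + e *: cross (b - a) m); split.
- exact/(ncone_edgeP em)/edge_cone0.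
- exact/(ncone_edgeP em)/edge_at_cone.
- exact/(ncone_edgeP em).
- rewrite !subr0 crossDr crossvv add0r crossZr cross_crossr m_ba scale0r subr0.
  by rewrite !scaler_eq0 dot_eq0 (negPf ba0) (negPf (edge_at_neq0 em)) gt_eqF.
Qed.

Lemma ncone_edge_perp m a b u : edge_at m a b -> u != 0 ->
  ncone P (face m) `<=` perp u <-> cross u (b - a) = 0.
Proof.
move=> em u0; split=> [sub|u_ba w /(ncone_edgeP em)[wb _]]; last first.
  have [t ->] : exists t, u = t *: (b - a).
    by apply/(cross_eq0P (edge_at_sub_neq0 em)); rewrite crossC u_ba oppr0.
  by rewrite /perp /= dotZr (dot_eq_sub.1 wb) mulr0.
pose z := cross (b - a) (cross u (b - a)).
have zb : dot z b = dot z a by apply/dot_eq_sub; rewrite dotC dot_crossl.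
have [e e0 cone_e] := near_right0_ex (edge_cone_ray em zb).
have zu : dot (m + e *: z) u = 0 by exact/sub/(ncone_edgeP em).
have mu : dot m u = 0 by exact/sub/(ncone_edgeP em)/edge_at_cone.
move: zu; rewrite dotDl dotZl mu add0r => /eqP.
rewrite mulf_eq0 gt_eqF//= => /eqP zu.
by apply/eqP; rewrite -dot_eq0 -dot_cross dotC zu.
Qed.

Lemma ncone_unique_max_not_perp c a u : a \in S -> unique_max S c a -> u != 0 ->
  ~ ncone P (face c) `<=` perp u.
Proof.
move=> aS max_a u0 sub.
have max_ncone w : supports w a -> ncone P (face c) w.
  by move=> max_w x y Px /(unique_max_face aS max_a) ->; exact: dot_conv_le Px.
have cu : perp u c.
  apply/sub/max_ncone => x xS.
  by have [->//|xa] := eqVneq x a; rewrite ltW ?max_a.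
suff /near_right0_ex[e e0 lt_e] : \forall e \near 0^'+, {in others a a,
    forall x, 0 < (dot c a - dot c x) + e * (dot u a - dot u x)}.
  have : perp u (c + e *: u).
    apply/sub/max_ncone => x /(others_cases a a)[->//|->//|/lt_e].
    by rewrite !dotDl !dotZl; lra.
  rewrite /perp /= dotDl dotZl cu add0r => /eqP.
  by rewrite mulf_eq0 dot_eq0 (negPf u0) gt_eqF.
apply: filter_in_seq => x; rewrite othersE => /and3P[xa _ xS].
by apply: near_right0_gt0; rewrite subr_gt0 max_a.
Qed.

Lemma ncone_facet_not_dim_ge2 c a b v : facet_at c a b v ->
  ~ dim_ge (ncone P (face c)) 2.
Proof.
move=> fac /dim_ge2P[p [q [r [Np Nq Nr /negP]]]]; apply.
have [fa fb fv] := facet_at_face fac; have Pface x : face c x -> P x by case.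
have abv := facet_at_noncollinear fac.
have Nline n : ncone P (face c) n -> exists t, n = t *: cross (b - a) (v - a).
  move=> Nn; apply: orthogonal_cross => //; apply/dot_eq_sub/eqP;
    by rewrite eq_le !Nn//; exact: Pface.
have [[s ->] [t ->]] := (Nline _ Np, Nline _ Nq); have [t' ->] := Nline _ Nr.
by rewrite -!scalerBl crossZl crossZr crossvv !scaler0.
Qed.

Lemma agg_coneP u w : u != 0 ->
  agg_cone P u w <-> exists a b, parallel_edge u a b /\ edge_cone a b w.
Proof.
move=> u0; split=> [[_ [[c ->] [dimN [sub Nw]]]]|]; last first.
  move=> [a [b [[u_ba [m em]] cone_w]]]; exists (face m).
  split; first by exists m.
  split; first exact: ncone_edge_dim em.
  by split; [exact/(ncone_edge_perp em)|exact/(ncone_edgeP em)].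
have [a aS max_a] := exists_supports c.
have [max1|[b em]|[b [v fac]]] := supports_cases aS max_a.
- by case: (ncone_unique_max_not_perp aS max1 u0 sub).
- exists a, b; split; last exact/(ncone_edgeP em).
  by split; [exact/(ncone_edge_perp em)|exists c].
- by case: (ncone_facet_not_dim_ge2 fac dimN.1).
Qed.

Arguments agg_coneP {u w}.

Lemma edge_cone_agg_cone u a b w :
  u != 0 -> parallel_edge u a b -> edge_cone a b w -> agg_cone P u w.
Proof. by move=> u0 par_ab cone_w; apply/(agg_coneP u0); exists a, b. Qed.

(** * Counting silhouette edges by direction *)

Lemma edge_at_direction m a b u :
  edge_at m a b -> normalized u -> cross u (b - a) = 0 -> edge_direction P u.
Proof.
move=> em [uu lead_u] u_ba; have u0 := dot_eq1_neq0 uu.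
split=> //; split; first exact/lead_coord_gt0P.
have [t ba_u] := (cross_eq0P u0).1 u_ba.
have [fa fb] := edge_at_face em; have [aS bS ab _ _] := edge_atP em.
have extreme_face x : x \in S -> face m x -> extreme (face m) x.
  move=> xS fx; split=> // y z s [Py _] [Pz _] s01 xyz.
  have [_ ext] := (extreme_convP S x).2 (conj xS (exposed_S xS)).
  exact: ext Py Pz s01 xyz.
exists (face m), a, b, t; split; last first.
  by do 2 (split; first exact: extreme_face).
split; first by exists m.
split; first exact: dim_ge1 fa fb ab.
move=> /dim_ge2P[x [y [z [fx fy fz]]]]; apply/negP; rewrite negbK; apply/eqP.
exact: cross_eq0_trans (edge_at_sub_neq0 em) (edge_face_parallel em fx fy)
  (edge_face_parallel em fx fz).
Qed.

Lemma edge_directionP u :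
  edge_direction P u <-> normalized u /\ exists a b, parallel_edge u a b.
Proof.
split=> [|[nu [a [b [u_ba [m em]]]]]]; last exact: edge_at_direction em nu u_ba.
move=> [uu [/lead_coord_gt0P lead_u [E [x [y [t]]]]]].
move=> [[[c ->] [_ dim2]] [[fx _] [[fy _] [xy yx_u]]]]; split=> //.
have t0 : t != 0.
  apply: contra_neq xy => t0.
  by apply/esym/eqP; rewrite -subr_eq0 yx_u t0 scale0r.
have [a aS max_a] := exists_supports c.
have [max1|[b em]|[b [v fac]]] := supports_cases aS max_a.
- move: xy; rewrite (unique_max_face aS max1 fx).
  by rewrite (unique_max_face aS max1 fy) eqxx.
- exists a, b; split; last by exists c.
  have /eqP := edge_face_parallel em fx fy.
  rewrite yx_u crossZr scaler_eq0 (negPf t0) /= => /eqP ba_u.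
  by rewrite crossC ba_u oppr0.
- have [fa fb fv] := facet_at_face fac; case: dim2; apply/dim_ge2P.
  by exists a, b, v; split=> //; exact: facet_at_noncollinear fac.
Qed.

Lemma edge_direction_neq0 u : edge_direction P u -> u != 0.
Proof. by case=> /dot_eq1_neq0. Qed.

Definition oriented_along u (ab : vec * vec) :=
  (cross u (ab.2 - ab.1) == 0) && (0 < dot u (ab.2 - ab.1)).

(* [m] lies in the relative interior of the normal cone of an edge parallel to
   [u]; of the two orderings of that edge only the one along [u] counts. *)
Definition edge_normal u m :=
  has (fun ab => oriented_along u ab && edge_at m ab.1 ab.2) vertex_pairs.

Definition parallel_count u d := count (fun ab =>
  (cross u (ab.2 - ab.1) == 0) && silhouette_edge d ab.1 ab.2) vertex_pairs.

Lemma dot_parallel_neq0 u a b :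
  a != b -> u != 0 -> cross u (b - a) = 0 -> dot u (b - a) != 0.
Proof.
rewrite eq_sym -subr_eq0 => ab u0 /(cross_eq0P u0)[t ba_u].
rewrite ba_u dotZr mulf_neq0 ?dot_eq0//.
by apply: contra_neq ab => t0; rewrite ba_u t0 scale0r.
Qed.

Lemma edge_normalP u m : u != 0 ->
  reflect (exists a b, cross u (b - a) = 0 /\ edge_at m a b) (edge_normal u m).
Proof.
move=> u0; apply: (iffP hasP) => [[[a b] _ /andP[/andP[/eqP u_ba _] em]]|].
  by exists a, b.
move=> [a [b [u_ba em]]]; have [aS bS ab _ _] := edge_atP em.
have [neg|pos|/eqP] := ltgtP (dot u (b - a)) 0.
- exists (b, a); rewrite ?mem_vertex_pairs ?bS//= edge_atC em andbT.
  rewrite /oriented_along /=.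
  by rewrite -opprB crossNr u_ba oppr0 eqxx dotNr oppr_gt0.
- exists (a, b); rewrite ?mem_vertex_pairs ?aS//= em /oriented_along /=.
  by rewrite u_ba eqxx pos.
- by rewrite (negPf (dot_parallel_neq0 ab u0 u_ba)).
Qed.

Arguments edge_normalP {u m}.

Lemma edge_at_inj m a b a' b' : edge_at m a b -> edge_at m a' b' ->
  (a', b') = (a, b) \/ (a', b') = (b, a).
Proof.
move=> /edge_atP[aS _ _ _ m_lt] em'.
have [aS' bS' ab' mb' _] := edge_atP em'; have max_a' := edge_at_supports em'.
have mem_ab x : x \in S -> dot m x = dot m a' -> x = a \/ x = b.
  move=> xS mx; case: (others_cases a b xS) => [->|->|/m_lt].
  - by left.
  - by right.
  - by rewrite mx ltNge max_a'.
move: ab'; have [->|->] := mem_ab a' aS' erefl;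
  have [->|->] := mem_ab b' bS' mb'; rewrite ?eqxx// => _; [by left|by right].
Qed.

Lemma count_edge_normal u m :
  count (fun ab => oriented_along u ab && edge_at m ab.1 ab.2) vertex_pairs =
  edge_normal u m.
Proof.
apply: count_uniq_has uniq_vertex_pairs _ => -[a b] [a' b'] _ _ /=.
move=> /andP[/andP[_ /= pos] em] /andP[/andP[_ /= pos'] em'].
have [->//|[ea eb]] := edge_at_inj em em'.
by exfalso; move: pos pos'; rewrite ea eb -opprB dotNr; lra.
Qed.

Lemma silhouette_edge_at d u a b : cross u (b - a) = 0 -> 0 < dot u (b - a) ->
  silhouette_edge d a b = edge_at (cross u d) a b.
Proof.
move=> u_ba pos.
have u0 : u != 0 by apply: contraTneq pos => ->; rewrite dot0l ltxx.
have [t ba_u] := (cross_eq0P u0).1 u_ba.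
have t0 : 0 < t by move: pos; rewrite ba_u dotZr pmulr_lgt0 ?dot_gt0.
have eq_ab : dot (cross u d) b == dot (cross u d) a.
  by apply/eqP/dot_eq_sub; rewrite ba_u dotZr dotC dot_crossl mulr0.
rewrite /silhouette_edge /edge_at eq_ab.
congr [&& _, _, _ & _]; apply: eq_all => x.
rewrite /orient ba_u crossZl dotZr pmulr_rgt0// -[RHS]subr_gt0 -dotBr.
by rewrite dot_cross crossC dotNl -dotNr opprB.
Qed.

Lemma parallel_countE u d : u != 0 ->
  parallel_count u d =
    (edge_normal u (cross u d) + edge_normal u (cross d u))%N.
Proof.
move=> u0; rewrite /parallel_count.
rewrite (count_predI_predC _ (fun ab => 0 < dot u (ab.2 - ab.1))).
rewrite -!count_edge_normal; congr addn.
  apply: eq_count => -[a b] /=; rewrite /oriented_along /= andbAC.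
  apply: andb_id2l => /andP[/eqP u_ba pos]; exact: silhouette_edge_at.
rewrite [LHS]count_allpairs_swap; apply: eq_count => -[a b] /=.
rewrite /oriented_along /= -opprB crossNr oppr_eq0 -[LHS]andbA -[RHS]andbA.
apply: andb_id2l => /eqP u_ba; rewrite dotNr oppr_gt0.
have [pos|neg|zero] /= := ltgtP 0 (dot u (b - a)).
- rewrite andbT edge_atC crossC -crossNl; apply: silhouette_edge_at.
    by rewrite -[a - b]opprB crossNl crossNr u_ba !oppr0.
  by rewrite -[a - b]opprB dotNl dotNr opprK.
- by rewrite andbF.
rewrite andbT; apply/negP => /silhouette_edgeP[_ _ ba _].
rewrite eq_sym in ba.
by have := dot_parallel_neq0 ba u0 u_ba; rewrite -zero eqxx.
Qed.

Definition edge_directions := undup [seq direction (ab.2 - ab.1) |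
  ab <- vertex_pairs & `[< exists m, edge_at m ab.1 ab.2 >]].

Lemma edge_directions_edge_direction u :
  u \in edge_directions -> edge_direction P u.
Proof.
rewrite mem_undup => /mapP[[a b]].
rewrite mem_filter => /andP[/asboolP[m em] _] ->.
have ba0 := edge_at_sub_neq0 em; have nd := normalized_direction ba0.
apply: (edge_at_direction em nd); exact: (direction_eqP ba0 nd).1.
Qed.

Lemma silhouette_sizeE d :
  silhouette_size d = (\sum_(u <- edge_directions) parallel_count u d)%N.
Proof.
rewrite /silhouette_size (count_fibers (h := fun ab => direction (ab.2 - ab.1))
  (D := edge_directions)) ?undup_uniq//.
  apply: eq_big_seq => u /edge_directions_edge_direction/edge_directionP[nu _].
  apply: eq_count => -[a b] /=; apply: andb_id2r => /silhouette_edgeP[_ _ ab _].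
  by apply/eqP/eqP => /direction_eqP; apply=> //; rewrite subr_eq0 eq_sym.
move=> [a b] ab_pair sil; have [_ _ ab _] := silhouette_edgeP sil.
rewrite mem_undup (map_f (fun ab => direction (ab.2 - ab.1)))//.
rewrite mem_filter ab_pair andbT; apply/asboolP; exists (cross (b - a) d).
by rewrite -silhouette_edge_at ?crossvv// dot_gt0 subr_eq0 eq_sym.
Qed.

(** * Cone condition implies equiprojectivity *)

Lemma agg_cone_perp u : agg_cone P u `<=` perp u.
Proof. by move=> w [F [_ [_ [sub Fw]]]]; exact: sub. Qed.

Lemma aff_negset_agg_cone_perp u : aff (negset (agg_cone P u)) `<=` perp u.
Proof.
move=> _ [n [p [t [Cp [_ ->]]]]]; rewrite /perp /=.
rewrite (big_morph _ (fun x y => dotDl x y u) (dot0l u)) big1// => i _.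
have /agg_cone_perp := Cp i.
rewrite /perp /= dotNl dotZl => /eqP; rewrite oppr_eq0 => /eqP->.
by rewrite mulr0.
Qed.

Lemma edge_normal_agg_cone u m : u != 0 -> edge_normal u m -> agg_cone P u m.
Proof.
move=> u0 /(edge_normalP u0)[a [b [u_ba em]]].
apply: edge_cone_agg_cone (edge_at_cone em) => //.
by split=> //; exists m.
Qed.

Lemma agg_cone_edge_normal u m : u != 0 ->
  (forall a b v, cross u (b - a) = 0 -> ~ facet_at m a b v) ->
  agg_cone P u m <-> edge_normal u m.
Proof.
move=> u0 not_facet; split; last exact: edge_normal_agg_cone.
move=> /(agg_coneP u0)[a [b [[u_ba [c /edge_atP[aS bS ab _ _]]] [mb max_a]]]].
apply/edge_normalP => //; exists a, b; split=> //.
apply/edge_atP; split=> // x xab.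
rewrite lt_neqAle max_a ?(others_sub xab)// andbT.
by apply/eqP => mx; case: (not_facet a b x u_ba).
Qed.

Lemma edge_normal_relint u w : u != 0 -> edge_normal u (- w) ->
  relint (negset (agg_cone P u)) w.
Proof.
move=> u0 en; split; first exact: edge_normal_agg_cone.
have /(edge_normalP u0)[a [b [u_ba em]]] := en.
have [e e0 cone_e] := near_right0_ex (edge_cone_ball em).
have wu : dot w u = 0.
  have := agg_cone_perp (edge_normal_agg_cone u0 en).
  by rewrite /perp /= dotNl; lra.
exists e; split=> // y /aff_negset_agg_cone_perp yu yw.
apply: (@edge_cone_agg_cone _ a b) => //; first by split=> //; exists (- w).
have -> : - y = - w + (w - y) by rewrite addKr.
apply: cone_e; first by rewrite -opprB dotNl dotNr opprK.
by apply: dot_parallel_eq u_ba _; rewrite // dotBl wu yu subrr.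
Qed.

Lemma generic_agg_coneP d u m : generic d -> u != 0 -> m != 0 -> dot m d = 0 ->
  agg_cone P u m <-> edge_normal u m.
Proof.
move=> gen_d u0 m0 md; apply: agg_cone_edge_normal => // a b v _.
exact: generic_not_facet_at gen_d m0 md.
Qed.

Lemma generic_cross_neq0 d u :
  edge_direction P u -> generic d -> cross u d != 0.
Proof.
move=> /edge_directionP[nu [a [b [u_ba [m em]]]]] gen_d.
apply: contra_neq (generic_edge gen_d em) => ud.
have [t ->] := (cross_eq0P (normalized_neq0 nu)).1 u_ba.
by rewrite crossZr crossC ud oppr0 scaler0.
Qed.

Lemma parallel_count_agg_cone u d : edge_direction P u -> generic d ->
  parallel_count u d =
    (`[< agg_cone P u (cross u d) >] + `[< agg_cone P u (cross d u) >])%N.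
Proof.
move=> edge_u gen_d; have u0 := edge_direction_neq0 edge_u.
have ud0 := generic_cross_neq0 edge_u gen_d.
have agg_normal m : m != 0 -> dot m d = 0 ->
    `[< agg_cone P u m >] = edge_normal u m.
  by move=> m0 md; apply/asboolP/idP => /(generic_agg_coneP gen_d u0 m0 md).
have du0 : cross d u != 0 by rewrite crossC oppr_eq0.
by rewrite parallel_countE// !agg_normal// dotC ?dot_crossl ?dot_crossr.
Qed.

Lemma parallel_count_full u d : edge_direction P u -> generic d ->
  agg_cone P u = perp u -> parallel_count u d = 2.
Proof.
move=> edge_u gen_d full; rewrite parallel_count_agg_cone// full.
by rewrite !asboolT//= /perp /= dotC ?dot_crossl ?dot_crossr.
Qed.

Definition splits_plane u :=
  agg_cone P u `&` relint (negset (agg_cone P u)) = set0 /\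
  agg_cone P u `|` relint (negset (agg_cone P u)) = perp u.

Lemma parallel_count_splits u d : edge_direction P u -> generic d ->
  splits_plane u -> parallel_count u d = 1.
Proof.
move=> edge_u gen_d [disj cover].
have u0 := edge_direction_neq0 edge_u.
rewrite parallel_count_agg_cone// [cross d u]crossC; set r := cross u d.
have r0 : r != 0 by exact: generic_cross_neq0.
have rd : dot r d = 0 by rewrite dotC dot_crossr.
have : (agg_cone P u `|` relint (negset (agg_cone P u))) r.
  by rewrite cover /perp /= dotC dot_crossl.
have not_both : agg_cone P u r -> ~ agg_cone P u (- r).
  move=> Cr /(generic_agg_coneP gen_d u0)/(edge_normal_relint u0) rel_r.
  have [] // : set0 r; rewrite -disj; split=> //.
  by apply: rel_r; rewrite ?oppr_eq0// dotNl rd oppr0.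
case=> [Cr|[CNr _]]; first by rewrite asboolT// asboolF//; exact: not_both.
by rewrite asboolF ?asboolT// => /not_both.
Qed.

Lemma cone_condition_equiprojective :
  (forall u, edge_direction P u -> agg_cone P u = perp u \/ splits_plane u) ->
  equiprojective P.
Proof.
move=> cond.
exists (\sum_(u <- edge_directions)
  if `[< agg_cone P u = perp u >] then 2 else 1)%N.
move=> d d0 gen_d; have := card_extreme_proj d0 gen_d; rewrite silhouette_sizeE.
congr card_eq; apply: eq_big_seq => u /edge_directions_edge_direction edge_u.
case: asboolP => [full|not_full]; first exact: parallel_count_full.
by have [/not_full|/(parallel_count_splits edge_u gen_d)] := cond u edge_u.
Qed.

(** * Equiprojectivity implies the cone condition *)

Definition plane_normals := [seq y <-
  [seq cross (ab.2 - ab.1) (v - ab.1) | ab <- vertex_pairs, v <- S] | y != 0].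

Lemma mem_plane_normals a b v :
  a \in S -> b \in S -> v \in others a b -> a != b ->
  cross (b - a) (v - a) \in plane_normals.
Proof.
move=> aS bS vab ab; rewrite mem_filter noncollinear//=.
apply/allpairsP; exists ((a, b), v).
by rewrite mem_vertex_pairs aS bS (others_sub vab).
Qed.

Definition generic_offset u x :=
  {in plane_normals, forall y, dot u y = 0 -> dot x y != 0}.

Lemma generic_offsetN u x : generic_offset u x -> generic_offset u (- x).
Proof. by move=> gen_x y yN uy; rewrite dotNl oppr_eq0 gen_x. Qed.

Lemma generic_plane_normals d :
  {in plane_normals, forall y, dot d y != 0} -> generic d.
Proof.
move=> dN F [[c ->] [/dim_ge2_face[a [b [v fac]]] _]] [n [n0 [nd n_face]]].
have [fa fb fv] := facet_at_face fac; have [aS bS vab ab _] := fac.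
have [t nt] := orthogonal_cross (facet_at_noncollinear fac)
  (n_face b a fb fa) (n_face v a fv fa).
have t0 : t != 0 by apply: contra_neq n0 => t0; rewrite nt t0 scale0r.
move: nd; rewrite nt dotZl => /eqP.
rewrite mulf_eq0 (negPf t0) dotC /=; apply/negP.
exact/dN/mem_plane_normals.
Qed.

Lemma near_generic u x : generic_offset u x ->
  \forall e \near 0^'+, generic (u + e *: x).
Proof.
move=> gen_x.
have : \forall e \near 0^'+,
    {in plane_normals, forall y, dot u y + e * dot x y != 0}.
  apply: filter_in_seq => y yN; apply: near_right0_neq0.
  by have [uy|//] := eqVneq (dot u y) 0; rewrite gen_x.
apply: filterS => e neq0; apply: generic_plane_normals => y /neq0.
by rewrite dotDl dotZl.
Qed.

Definition limit_edge u x a b := [&& a \in S, b \in S, a != b &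
  all (fun v => lex_pos (orient u a b v) (orient x a b v)) (others a b)].

Lemma limit_edgeP u x a b : reflect
  [/\ a \in S, b \in S, a != b &
      {in others a b, forall v, lex_pos (orient u a b v) (orient x a b v)}]
  (limit_edge u x a b).
Proof. by apply: (iffP and4P) => -[aS bS ab /allP]. Qed.

Lemma near_limit_edge u x : \forall e \near 0^'+, {in vertex_pairs, forall ab,
  silhouette_edge (u + e *: x) ab.1 ab.2 = limit_edge u x ab.1 ab.2}.
Proof.
apply: filter_in_seq => -[a b] _.
have : \forall e \near 0^'+, {in others a b, forall v,
    (0 < orient u a b v + e * orient x a b v) =
      lex_pos (orient u a b v) (orient x a b v)}.
  by apply: filter_in_seq => v _; exact: near_right0_lex_pos.
apply: filterS => e lexE; congr [&& _, _, _ & _]; apply: eq_in_all => v vab.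
by rewrite -lexE// /orient dotDl dotZl.
Qed.

Definition limit_size u x :=
  count (fun ab => limit_edge u x ab.1 ab.2) vertex_pairs.

Lemma equiprojective_limit_size k u x :
  k_equiprojective P k -> edge_direction P u ->
  generic_offset u x -> limit_size u x = k.
Proof.
move=> Pk edge_u gen_x.
have [e _ [gen_e lim_e]] :=
  near_right0_ex (filterI (near_generic gen_x) (near_limit_edge u x)).
have d0 : u + e *: x != 0.
  by apply: contra_neq (generic_cross_neq0 edge_u gen_e) => ->; rewrite cross0r.
have := card_eq_inj (card_extreme_proj d0 gen_e) (Pk _ d0 gen_e).
by move=> <-; apply: eq_in_count => ab /lim_e.
Qed.

Lemma limit_edge_parallel u x a b : u != 0 -> cross u (b - a) = 0 ->
  limit_edge u x a b = silhouette_edge x a b.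
Proof.
move=> u0 /(cross_eq0P u0)[t ba_u].
congr [&& _, _, _ & _]; apply: eq_all => v.
by rewrite /lex_pos {1 2}/orient ba_u crossZl dotZr dot_crossl mulr0 ltxx eqxx.
Qed.

(* A facet whose normal is orthogonal to [u] and which contains [ab] has the
   normal [u x (b - a)] up to sign, so [limit_edge u x a b] depends on [x] only
   through the side of the plane orthogonal to [u x (b - a)]. *)
Lemma limit_edge_same_side u x x' a b : cross u (b - a) != 0 ->
  generic_offset u x' ->
  0 <= dot x (cross u (b - a)) * dot x' (cross u (b - a)) ->
  limit_edge u x a b -> limit_edge u x' a b.
Proof.
move=> u_ba gen_x' same /limit_edgeP[aS bS ab lex_ab].
apply/limit_edgeP; split=> // v vab.
case/orP: (lex_ab v vab) => [pos|/andP[/eqP zero pos]]; rewrite /lex_pos.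
  by rewrite pos.
have := gen_x' _ (mem_plane_normals aS bS vab ab) zero; move: pos.
rewrite zero eqxx ltxx /=; rewrite /orient in zero *.
have yu : dot (cross (b - a) (v - a)) u = 0 by rewrite dotC.
have y_ba : dot (cross (b - a) (v - a)) (b - a) = 0 by rewrite dotC dot_crossl.
have [t ->] := orthogonal_cross u_ba yu y_ba.
rewrite !dotZr => pos x'0; rewrite lt_def x'0 /=; nra.
Qed.

Lemma limit_edge_addN_const u x x' a b : cross u (b - a) != 0 ->
  generic_offset u x -> generic_offset u x' ->
  (limit_edge u x a b + limit_edge u (- x) a b =
   limit_edge u x' a b + limit_edge u (- x') a b)%N.
Proof.
move=> u_ba gen_x gen_x'.
have same y y' : generic_offset u y -> generic_offset u y' ->
    0 <= dot y (cross u (b - a)) * dot y' (cross u (b - a)) ->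
    limit_edge u y a b = limit_edge u y' a b.
  move=> gen_y gen_y' yy'.
  by apply/idP/idP; apply: limit_edge_same_side; rewrite // mulrC.
have gen_Nx := generic_offsetN gen_x; have gen_Nx' := generic_offsetN gen_x'.
have [xx'|xx'] := leP 0 (dot x (cross u (b - a)) * dot x' (cross u (b - a))).
  by rewrite (same x x')// (same (- x) (- x'))// !dotNl mulrNN.
rewrite addnC (same (- x) x') ?(same x (- x'))// dotNl ?mulrN ?mulNr;
  by rewrite oppr_ge0 ltW.
Qed.

Definition transverse_count u x := count (fun ab =>
  (cross u (ab.2 - ab.1) != 0) && limit_edge u x ab.1 ab.2) vertex_pairs.

Lemma limit_sizeE u x : u != 0 ->
  limit_size u x = (parallel_count u x + transverse_count u x)%N.
Proof.
move=> u0; rewrite /limit_size.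
rewrite (count_predI_predC _ (fun ab => cross u (ab.2 - ab.1) == 0)).
congr addn; apply: eq_count => -[a b] /=; rewrite andbC//.
by apply: andb_id2l => /eqP; exact: limit_edge_parallel.
Qed.

Lemma transverse_count_addN_const u x x' :
  generic_offset u x -> generic_offset u x' ->
  (transverse_count u x + transverse_count u (- x) =
   transverse_count u x' + transverse_count u (- x'))%N.
Proof.
move=> gen_x gen_x'; apply: eq_in_count_add => -[a b] _ /=.
by have [//|u_ba] := eqVneq (cross u (b - a)) 0; exact: limit_edge_addN_const.
Qed.

Lemma parallel_countN u x :
  u != 0 -> parallel_count u (- x) = parallel_count u x.
Proof.
by move=> u0; rewrite !parallel_countE// crossNl crossNr -!crossC addnC.
Qed.

Lemma equiprojective_parallel_count_const k u x x' : k_equiprojective P k ->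
  edge_direction P u -> generic_offset u x -> generic_offset u x' ->
  parallel_count u x = parallel_count u x'.
Proof.
move=> Pk edge_u gen_x gen_x'; have u0 := edge_direction_neq0 edge_u.
have size_k y : generic_offset u y ->
    (parallel_count u y + transverse_count u y)%N = k.
  by rewrite -limit_sizeE//; exact: equiprojective_limit_size.
have := size_k _ gen_x; have := size_k _ (generic_offsetN gen_x).
have := size_k _ gen_x'; have := size_k _ (generic_offsetN gen_x').
rewrite !parallel_countN//.
have := transverse_count_addN_const gen_x gen_x'; lia.
Qed.

Section UnitDirection.
Variable u : vec.
Hypothesis uu : dot u u = 1.

Let u0 : u != 0 := dot_eq1_neq0 uu.

Notation C := (agg_cone P u).

Definition generic_normal m := dot m u = 0 /\ generic_offset u (cross u m).

Lemma generic_normalN m : generic_normal m -> generic_normal (- m).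
Proof.
move=> [mu gen_m]; split; first by rewrite dotNl mu oppr0.
by rewrite crossNr; exact: generic_offsetN.
Qed.

Lemma exists_generic_normal : exists m, generic_normal m.
Proof.
have [|g gN] := @exists_nonorthogonal _ plane_normals.
  by move=> y; rewrite mem_filter => /andP[].
exists (cross g u); split; first by rewrite dotC dot_crossr.
move=> y yN uy; rewrite cross_crossr uu scale1r dotBl dotZl uy mulr0 subr0.
exact: gN.
Qed.

Lemma near_generic_normal w m : dot w u = 0 -> generic_normal m ->
  \forall e \near 0^'+, generic_normal (w + e *: m).
Proof.
move=> wu [mu gen_m].
have : \forall e \near 0^'+, {in plane_normals, forall y, dot u y = 0 ->
    dot (cross u w) y + e * dot (cross u m) y != 0}.
  apply: filter_in_seq => y yN; have [uy|uy] := eqVneq (dot u y) 0.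
    have wm : (dot (cross u w) y != 0) || (dot (cross u m) y != 0).
      by rewrite gen_m ?orbT.
    by apply: filterS (near_right0_neq0 wm).
  by apply: filterE => e /eqP; rewrite (negPf uy).
apply: filterS => e neq0; split; first by rewrite dotDl dotZl wu mu mulr0 addr0.
by move=> y yN uy; rewrite crossDr crossZr dotDl dotZl neq0.
Qed.

Lemma generic_normal_agg_cone m : generic_normal m -> C m <-> edge_normal u m.
Proof.
move=> [mu gen_m]; apply: agg_cone_edge_normal => // a b v u_ba fac.
have [aS bS vab ab _] := fac; have [t mt] := facet_at_cross fac.
have uy : dot u (cross (b - a) (v - a)) = 0 by rewrite dot_cross u_ba dot0l.
have := gen_m _ (mem_plane_normals aS bS vab ab) uy.
by rewrite mt crossZr dotZl [dot (cross _ _) _]dotC dot_crossr mulr0 eqxx.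
Qed.

Lemma exists_generic_normal_edge_cone a b : parallel_edge u a b ->
  exists2 m, generic_normal m & edge_cone a b m.
Proof.
move=> [u_ba [m em]]; have [q gen_q] := exists_generic_normal.
have mu : dot m u = 0.
  apply: (@agg_cone_perp u); apply: edge_cone_agg_cone (edge_at_cone em) => //.
  by split=> //; exists m.
have qb : dot q b = dot q a.
  by apply: dot_parallel_eq u_ba _ => //; case: gen_q.
have [e _ [gen_e cone_e]] :=
  near_right0_ex (filterI (near_generic_normal mu gen_q) (edge_cone_ray em qb)).
by exists (m + e *: q).
Qed.

Lemma near_not_agg_cone w : dot w u = 0 -> ~ C w ->
  \forall e \near 0^'+, forall z, dot z z < e -> ~ C (w + z).
Proof.
move=> wu nCw.
have : \forall e \near 0^'+, {in vertex_pairs, forall ab,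
    parallel_edge u ab.1 ab.2 ->
    forall z, dot z z < e -> ~ edge_cone ab.1 ab.2 (w + z)}.
  apply: filter_in_seq => -[a b] _ /=.
  have [par_ab|not_par] := pselect (parallel_edge u a b); last exact: filterE.
  have : ~ edge_cone a b w.
    by move=> cone_w; apply: nCw; exact: edge_cone_agg_cone cone_w.
  move=> /not_andP[|/existsNP[x /not_implyP[xS /negP]]].
    by case: par_ab => u_ba _; rewrite (dot_parallel_eq u0 u_ba wu).
  rewrite -ltNge -subr_gt0 => wx.
  apply: filterS (near_right0_ball_gt0 (x - a) wx) => e pos _ z /pos wz.
  move=> [_ /(_ x xS)].
  by move: wz; rewrite !dotDl dotBr; lra.
apply: filterS => e not_cone z ze /(agg_coneP u0)[a [b [par_ab cone_wz]]].
have [_ [m /edge_atP[aS bS _ _ _]]] := par_ab.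
by apply: (not_cone (a, b)) ze cone_wz; rewrite ?mem_vertex_pairs ?aS.
Qed.

Lemma near_agg_cone w m : dot w u = 0 ->
  (\forall e \near 0^'+, C (w + e *: m)) -> C w.
Proof.
move=> wu near_C; apply: contrapT.
move=> /(near_not_agg_cone wu)/(near_right0_ray m) near_nC.
by have [e _ []] := near_right0_ex (filterI near_C near_nC).
Qed.

Lemma agg_cone_full :
  (forall m, generic_normal m -> C m) -> C = perp u.
Proof.
move=> gen_C; apply/seteqP; split=> [|w wu]; first exact: agg_cone_perp.
have [q gen_q] := exists_generic_normal.
apply: (near_agg_cone (m := q)) => //.
by apply: filterS (near_generic_normal wu gen_q) => e; exact: gen_C.
Qed.

Lemma agg_cone_disjoint :
  (forall m, generic_normal m -> C m -> ~ C (- m)) ->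
  C `&` relint (negset C) = set0.
Proof.
move=> not_both; apply/seteqP; split=> // w [Cw [CNw [r [r0 ball_r]]]].
have [a [b [par_ab cone_w]]] := (agg_coneP u0).1 Cw.
have [m gen_m cone_m] := exists_generic_normal_edge_cone par_ab.
have cone_C := edge_cone_agg_cone u0 par_ab.
have small : \forall e \near 0^'+, dot (e *: m) (e *: m) < r.
  apply: (near_right0_ray (Q := fun z => dot z z < r)).
  by apply: filterS (nbhs_right_lt r0) => e er z /lt_trans; apply.
have [e e0 [small_e gen_e]] :=
  near_right0_ex (filterI small (near_generic_normal (agg_cone_perp Cw) gen_m)).
apply: (not_both _ gen_e).
  exact/cone_C/(edge_coneD (ltW e0) cone_w).
apply: ball_r; last by rewrite addrC addKr.
have -> : w + e *: m = w + e *: (0 - - m) by rewrite sub0r opprK.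
apply: aff_add_scale_sub => //.
  by rewrite /negset /= oppr0; exact/cone_C/edge_cone0.
by rewrite /negset /= opprK; exact: cone_C.
Qed.

Lemma agg_cone_cover :
  (forall m, generic_normal m -> C m \/ C (- m)) ->
  C `|` relint (negset C) = perp u.
Proof.
move=> gen_C.
have cover w : dot w u = 0 -> ~ C w -> C (- w).
  move=> wu nCw; have [q gen_q] := exists_generic_normal.
  apply: (near_agg_cone (m := - q)); first by rewrite dotNl wu oppr0.
  have near_nC := near_right0_ray q (near_not_agg_cone wu nCw).
  apply: filterS2 near_nC (near_generic_normal wu gen_q) => e nC.
  by move=> /gen_C[/nC//|]; rewrite opprD scalerN.
apply/seteqP; split=> [w [|[/agg_cone_perp]]|w wu]; first exact: agg_cone_perp.
  by rewrite /perp /= dotNl; lra.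
have [Cw|nCw] := pselect (C w); [by left|right; split; first exact: cover].
have [e e0 nC] := near_right0_ex (near_not_agg_cone wu nCw).
exists e; split=> // y /aff_negset_agg_cone_perp yu yw; apply: cover => //.
by have := nC _ yw; rewrite addrC subrK.
Qed.

Lemma edge_normal_addN_const k m m' :
  k_equiprojective P k -> edge_direction P u ->
  generic_normal m -> generic_normal m' ->
  (edge_normal u m + edge_normal u (- m) =
   edge_normal u m' + edge_normal u (- m'))%N.
Proof.
move=> Pk edge_u gen_m gen_m'.
have countE n : generic_normal n ->
    (edge_normal u n + edge_normal u (- n))%N = parallel_count u (cross u n).
  move=> [nu _]; rewrite parallel_countE// [cross _ u]crossC cross_crossr.
  by rewrite dotC nu scale0r sub0r uu scale1r opprK addnC.
rewrite !countE//; have [[_ off] [_ off']] := (gen_m, gen_m').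
exact: equiprojective_parallel_count_const Pk edge_u off off'.
Qed.

Lemma equiprojective_cone_condition k :
  k_equiprojective P k -> edge_direction P u -> C = perp u \/ splits_plane u.
Proof.
move=> Pk edge_u; have [_ [a [b par_ab]]] := (edge_directionP u).1 edge_u.
have [m0 gen_m0 cone_m0] := exists_generic_normal_edge_cone par_ab.
have Cm0 : edge_normal u m0.
  by apply/generic_normal_agg_cone => //; exact: edge_cone_agg_cone cone_m0.
have CE n : generic_normal n -> C n <-> edge_normal u n.
  exact: generic_normal_agg_cone.
have sumE m (gen_m : generic_normal m) :=
  edge_normal_addN_const Pk edge_u gen_m gen_m0.
move: sumE; rewrite Cm0.
have [CNm0|CNm0] := boolP (edge_normal u (- m0)) => sumE.
  left; apply: agg_cone_full => m gen_m; apply/CE => //.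
  by move: (sumE m gen_m); do 2 case: edge_normal.
right; split; [apply: agg_cone_disjoint|apply: agg_cone_cover] => m gen_m.
  move=> /(CE m gen_m) Cm /(CE _ (generic_normalN gen_m)) CNm.
  by move: (sumE m gen_m); rewrite Cm CNm.
have := sumE m gen_m; have [Cm _|_] := boolP (edge_normal u m).
  by left; exact/CE.
have [CNm _|//] := boolP (edge_normal u (- m)).
by right; apply/CE => //; exact: generic_normalN.
Qed.

End UnitDirection.

End Polytope.

Theorem theorem1p2 (R : realType) (P : set 'rV[R]_3) :
  polytope3 P ->
  (equiprojective P <->
   forall u : 'rV[R]_3, edge_direction P u ->
     agg_cone P u = perp u \/
     (agg_cone P u `&` relint (negset (agg_cone P u)) = set0 /\
      agg_cone P u `|` relint (negset (agg_cone P u)) = perp u)).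
Proof.
move=> [[V ->]]; have [S [uniq_S -> exposed_S]] := exists_vertex_seq V => dim3.
have nonplanar_S := dim_ge3_nonplanar dim3.
split=> [[k Pk] u edge_u|]; last exact: cone_condition_equiprojective.
by apply: (equiprojective_cone_condition _ _ _ _ Pk edge_u) => //; case: edge_u.
Qed.
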